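(* Let $\beta\in\{1,2,4\}$, $n\ge1$. For all $\lambda_1,\dots,\lambda_n\ge0$ with $\lambda_1+\dots+\lambda_n>0$, the Poisson ensemble $\mathrm{Poiss}(\lambda_1,\dots,\lambda_n)$ on $\mathbb{H}_{n,\beta}$ is a Meixner ensemble with parameters $A=0$, $B=1$, $C=0$.
   Context: For $\beta=1,2,4$, $\mathbb{H}_{n,\beta}$ is the real vector space of $n\times n$ real symmetric, complex Hermitian, respectively quaternionic Hermitian matrices; $\mathcal{K}_{n,\beta}$ is $O(n)$, $U(n)$, $Sp(n)$ (quaternionic unitary matrices) respectively. A law $\mu$ on $\mathbb{H}_{n,\beta}$ is rotation invariant if $U\mathbf XU^*\sim\mathbf X$ for all $U\in\mathcal{K}_{n,\beta}$ when $\mathbf X\sim\mu$. $\mu$ is a Meixner ensemble with parameters $A,B,C\in\mathbb R$ if it is rotation invariant, has finite second moments, and for $\mathbf X,\mathbf Y$ independent with law $\mu$ and $\mathbf S=\mathbf X+\mathbf Y$ one has $\mathbb{E}((\mathbf X-\mathbf Y)^2|\mathbf S)=A\mathbf S^2+B\mathbf S+C\mathbf I_n$. Let $\mathbf I_{m,n}$ be the $n\times n$ diagonal matrix with $m$ ones followed by $n-m$ zeros and let $\mu_m$ be the law of $\mathbf U\mathbf I_{m,n}\mathbf U^*$ with $\mathbf U$ Haar distributed on $\mathcal{K}_{n,\beta}$. The Bernoulli ensemble with parameters $q_1,\dots,q_n\ge0$, $q_1+\dots+q_n\le1$, is the law $q_0\delta_{\mathbf 0}+q_1\mu_1+\dots+q_{n-1}\mu_{n-1}+q_n\delta_{\mathbf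 I_n}$ with $q_0=1-(q_1+\dots+q_n)$. With $\lambda=\lambda_1+\dots+\lambda_n$, $\mathrm{Poiss}(\lambda_1,\dots,\lambda_n)$ is the law of $\sum_{k=1}^N\mathbf X_k$ (equal to $\mathbf 0$ if $N=0$), where $N$ is Poisson with mean $\lambda$ and independent of the i.i.d. sequence $\mathbf X_1,\mathbf X_2,\dots$ of Bernoulli ensembles with parameters $\lambda_1/\lambda,\dots,\lambda_n/\lambda$. *)

(* Defs.v *)
From HB Require Import structures.
From mathcomp Require Import all_boot all_order all_algebra.
From mathcomp Require Import all_classical all_reals all_analysis.
From mathcomp Require Import complex.
From mathcomp Require Import ring.
Set Implicit Arguments.
Unset Strict Implicit.
Unset Printing Implicit Defensive.
Import Order.TTheory GRing.Theory Num.Theory.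
Import numFieldNormedType.Exports.
Local Open Scope classical_set_scope.
Local Open Scope ring_scope.

HB.mixin Record hasInvolution (R : realType) K of GRing.Algebra R K := {
  star : K -> K;
  starK : involutive star;
  starD : {morph star : x y / x + y};
  starZ : forall a : R, {morph star : x / a *: x};
  starM : forall x y, star (x * y) = star y * star x
}.

(* finite-dimensional real *-algebras: the common interface of R, C and H *)
#[short(type="starAlgType")]
HB.structure Definition StarAlgebra (R : realType) :=
  { K of GRing.Algebra R K & Vector R K & hasInvolution R K }.

Section real_scalars.
Variable R : realType.

HB.instance Definition _ := hasInvolution.Build R R^o
  (fun=> erefl) (fun _ _ => erefl) (fun _ _ => erefl) (@mulrC R).

End real_scalars.

(* Rcomplex R is R[i] with its structure of algebra over R *)
Section complex_scalars.
Variable R : realType.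
Local Notation C := (Rcomplex R).

Let complex_scaleAr (a : R) (x y : C) : a *: (x * y) = x * (a *: y).
Proof. by case: x y => [x1 x2] [y1 y2]; congr Complex => /=; ring. Qed.

HB.instance Definition _ := GRing.Lalgebra_isAlgebra.Build R C complex_scaleAr.

Let complex_v2r (x : C) : 'rV[R]_2 :=
  \row_j nth 0 [:: complex.Re x; complex.Im x] j.

Let complex_vector : Vector.axiom 2 C.
Proof.
exists complex_v2r.
  move=> a [x1 x2] [y1 y2]; apply/rowP => j; rewrite !mxE.
  by case: j => [[|[|//]]].
exists (fun v : 'rV[R]_2 => Complex (v 0 0) (v 0 1)).
  by case=> a b; rewrite !mxE.
move=> v; apply/rowP => -[[|[|//]] lt_j2]; rewrite mxE /=;
by congr (v _ _); apply: val_inj.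
Qed.

HB.instance Definition _ := Lmodule_hasFinDim.Build R C complex_vector.

Let conjcZ (a : R) : {morph (@conjc R : C -> C) : x / a *: x}.
Proof. by case=> x y; congr Complex; rewrite mulrN. Qed.

Let conjcM (x y : C) : conjc (x * y) = (conjc y : C) * conjc x.
Proof. by rewrite rmorphM mulrC. Qed.

HB.instance Definition _ := hasInvolution.Build R C
  (@conjcK R) (@raddfD _ _ (@conjc R)) conjcZ conjcM.

End complex_scalars.

Record quaternion (R : Type) := Quaternion { q_re : R; q_i : R; q_j : R; q_k : R }.

Section quaternions.
Variable R : realType.
Local Notation H := (quaternion R).

Definition quaternion_tuple (x : H) := (q_re x, q_i x, q_j x, q_k x).

Definition tuple_quaternion (t : R * R * R * R) : H :=
  let: (a, b, c, d) := t in Quaternion a b c d.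

Lemma quaternion_tupleK : cancel quaternion_tuple tuple_quaternion.
Proof. by case. Qed.

HB.instance Definition _ := Choice.copy H (can_type quaternion_tupleK).

Definition quaternion0 : H := Quaternion 0 0 0 0.

Definition quaternion1 : H := Quaternion 1 0 0 0.

Definition quaternion_opp (x : H) : H :=
  Quaternion (- q_re x) (- q_i x) (- q_j x) (- q_k x).

Definition quaternion_add (x y : H) : H :=
  Quaternion (q_re x + q_re y) (q_i x + q_i y) (q_j x + q_j y) (q_k x + q_k y).

(* Hamilton product: i^2 = j^2 = k^2 = ijk = -1 *)
Definition quaternion_mul (x y : H) : H :=
  let: Quaternion a1 b1 c1 d1 := x in
  let: Quaternion a2 b2 c2 d2 := y in
  Quaternion (a1 * a2 - b1 * b2 - c1 * c2 - d1 * d2)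
             (a1 * b2 + b1 * a2 + c1 * d2 - d1 * c2)
             (a1 * c2 - b1 * d2 + c1 * a2 + d1 * b2)
             (a1 * d2 + b1 * c2 - c1 * b2 + d1 * a2).

Definition quaternion_scale (a : R) (x : H) : H :=
  Quaternion (a * q_re x) (a * q_i x) (a * q_j x) (a * q_k x).

Definition quaternion_conj (x : H) : H :=
  Quaternion (q_re x) (- q_i x) (- q_j x) (- q_k x).

Let addA : associative quaternion_add.
Proof. by move=> x y z; congr Quaternion; rewrite /= addrA. Qed.

Let addC : commutative quaternion_add.
Proof. by move=> x y; congr Quaternion; rewrite addrC. Qed.

Let add0 : left_id quaternion0 quaternion_add.
Proof. by case=> a b c d; congr Quaternion; rewrite /= add0r. Qed.

Let addN : left_inverse quaternion0 quaternion_opp quaternion_add.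
Proof. by move=> x; congr Quaternion; rewrite /= addNr. Qed.

HB.instance Definition _ := GRing.isZmodule.Build H addA addC add0 addN.

Let mulA : associative quaternion_mul.
Proof.
by move=> [a1 b1 c1 d1] [a2 b2 c2 d2] [a3 b3 c3 d3]; congr Quaternion; ring.
Qed.

Let qmul1l : left_id quaternion1 quaternion_mul.
Proof. by move=> [a b c d]; congr Quaternion; ring. Qed.

Let qmul1r : right_id quaternion1 quaternion_mul.
Proof. by move=> [a b c d]; congr Quaternion; ring. Qed.

Let mulDl : left_distributive quaternion_mul quaternion_add.
Proof.
by move=> [a1 b1 c1 d1] [a2 b2 c2 d2] [a3 b3 c3 d3]; congr Quaternion => /=; ring.
Qed.

Let mulDr : right_distributive quaternion_mul quaternion_add.
Proof.
by move=> [a1 b1 c1 d1] [a2 b2 c2 d2] [a3 b3 c3 d3]; congr Quaternion => /=; ring.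
Qed.

Let qone_neq0 : quaternion1 != 0 :> H.
Proof. by apply/eqP => -[] /eqP; rewrite oner_eq0. Qed.

HB.instance Definition _ := GRing.Zmodule_isNzRing.Build H
  mulA qmul1l qmul1r mulDl mulDr qone_neq0.

Let scaleA (a b : R) (x : H) :
  quaternion_scale a (quaternion_scale b x) = quaternion_scale (a * b) x.
Proof. by congr Quaternion; rewrite /= mulrA. Qed.

Let scale1 : left_id 1 quaternion_scale.
Proof. by case=> a b c d; congr Quaternion; rewrite /= mul1r. Qed.

Let scaleDr : right_distributive quaternion_scale +%R.
Proof. by move=> a x y; congr Quaternion; rewrite /= mulrDr. Qed.

Let scaleDl (x : H) : {morph quaternion_scale^~ x : a b / a + b}.
Proof. by move=> a b; congr Quaternion; rewrite /= mulrDl. Qed.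

HB.instance Definition _ := GRing.Zmodule_isLmodule.Build R H
  scaleA scale1 scaleDr scaleDl.

Let scaleAl (a : R) (x y : H) : a *: (x * y) = (a *: x) * y.
Proof.
by case: x y => [a1 b1 c1 d1] [a2 b2 c2 d2]; congr Quaternion => /=; ring.
Qed.

HB.instance Definition _ := GRing.Lmodule_isLalgebra.Build R H scaleAl.

Let scaleAr (a : R) (x y : H) : a *: (x * y) = x * (a *: y).
Proof.
by case: x y => [a1 b1 c1 d1] [a2 b2 c2 d2]; congr Quaternion => /=; ring.
Qed.

HB.instance Definition _ := GRing.Lalgebra_isAlgebra.Build R H scaleAr.

Let quaternion_v2r (x : H) : 'rV[R]_4 :=
  \row_j nth 0 [:: q_re x; q_i x; q_j x; q_k x] j.

Let quaternion_vector : Vector.axiom 4 H.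
Proof.
exists quaternion_v2r.
  move=> a x y; apply/rowP => j; rewrite !mxE.
  by case: j => [[|[|[|[|//]]]]].
exists (fun v : 'rV[R]_4 => Quaternion (v 0 0) (v 0 (inord 1)) (v 0 (inord 2))
                            (v 0 (inord 3))).
  by case=> a b c d; rewrite !mxE !inordK.
move=> v; apply/rowP => -[[|[|[|[|//]]]] lt_j4]; rewrite mxE /=;
by congr (v _ _); apply: val_inj; rewrite /= ?inordK.
Qed.

HB.instance Definition _ := Lmodule_hasFinDim.Build R H quaternion_vector.

Let conjK : involutive quaternion_conj.
Proof. by case=> a b c d; congr Quaternion; rewrite /= opprK. Qed.

Let conjD : {morph quaternion_conj : x y / x + y}.
Proof. by move=> x y; congr Quaternion; rewrite /= opprD. Qed.

Let conjZ (a : R) : {morph quaternion_conj : x / a *: x}.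
Proof. by move=> x; congr Quaternion; rewrite /= mulrN. Qed.

Let conjM (x y : H) :
  quaternion_conj (x * y) = quaternion_conj y * quaternion_conj x.
Proof.
by case: x y => [a1 b1 c1 d1] [a2 b2 c2 d2]; congr Quaternion => /=; ring.
Qed.

HB.instance Definition _ := hasInvolution.Build R H conjK conjD conjZ conjM.

End quaternions.

(* beta = 1, 2, 4 is the real dimension of the scalars; other values of beta
   are not used *)
Definition dyson_algebra (R : realType) (beta : nat) : starAlgType R :=
  match beta with
  | 1 => R^o
  | 2 => Rcomplex R
  | _ => quaternion R
  end.

Section hermitian_and_unitary.
Variables (R : realType) (K : starAlgType R).

Definition adjmx m n (A : 'M[K]_(m, n)) : 'M[K]_(n, m) := map_mx star A^T.

Let star0 : star (0 : K) = 0.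
Proof. by have := @starZ _ K 0 0; rewrite !scale0r. Qed.

Let star1 : star (1 : K) = 1.
Proof. by have := @starM _ K 1 (star 1); rewrite mul1r starK mul1r. Qed.

Lemma adjmxK m n : cancel (@adjmx m n) (@adjmx n m).
Proof. by move=> A; apply/matrixP => i j; rewrite !mxE starK. Qed.

Lemma adjmxD m n : {morph @adjmx m n : A B / A + B}.
Proof. by move=> A B; apply/matrixP => i j; rewrite !mxE starD. Qed.

Lemma adjmx0 m n : adjmx (0 : 'M[K]_(m, n)) = 0.
Proof. by apply/matrixP => i j; rewrite !mxE star0. Qed.

Lemma adjmxN m n : {morph @adjmx m n : A / - A}.
Proof. by move=> A; apply/eqP; rewrite -addr_eq0 -adjmxD addNr adjmx0. Qed.

Lemma adjmx_pid m n r : adjmx (pid_mx r : 'M[K]_(m, n)) = pid_mx r.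
Proof.
apply/matrixP => i j; rewrite !mxE eq_sym.
by case: eqP => [->|_] /=; first case: ltnP => _; rewrite ?star0 ?star1.
Qed.

Lemma adjmxM m n p (A : 'M[K]_(m, n)) (B : 'M[K]_(n, p)) :
  adjmx (A *m B) = adjmx B *m adjmx A.
Proof.
apply/matrixP => i j; rewrite !mxE (big_morph _ (@starD _ K) star0).
by apply: eq_bigr => k _; rewrite !mxE starM.
Qed.

Definition selfadjoint n : {pred 'M[K]_n} := fun A => adjmx A == A.

Let selfadjoint_zmod n : zmod_closed (@selfadjoint n).
Proof.
split=> [|A B]; rewrite !unfold_in ?adjmx0// => /eqP hA /eqP hB.
by rewrite adjmxD adjmxN hA hB.
Qed.

HB.instance Definition _ n :=
  GRing.isZmodClosed.Build 'M[K]_n (@selfadjoint n) (@selfadjoint_zmod n).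

Record herm n := Herm { herm_mx :> 'M[K]_n; hermP : herm_mx \in @selfadjoint n }.

HB.instance Definition _ n := [isSub for @herm_mx n].
HB.instance Definition _ n := [Choice of herm n by <:].
HB.instance Definition _ n := [SubChoice_isSubZmodule of herm n by <:].
HB.instance Definition _ n := isPointed.Build (herm n) 0.

Definition isunitary n : {pred 'M[K]_n} :=
  fun U => (U *m adjmx U == 1%:M) && (adjmx U *m U == 1%:M).

Record unitary n :=
  Unitary { unitary_mx :> 'M[K]_n; unitaryP : unitary_mx \in @isunitary n }.

HB.instance Definition _ n := [isSub for @unitary_mx n].
HB.instance Definition _ n := [Choice of unitary n by <:].

Lemma isunitary1 n : 1%:M \in @isunitary n.
Proof. by rewrite unfold_in -pid_mx_1 adjmx_pid pid_mx_1 mulmx1 eqxx. Qed.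

HB.instance Definition _ n := isPointed.Build (unitary n) (Unitary (isunitary1 n)).

Lemma isunitaryM n (U V : unitary n) : U *m V \in @isunitary n.
Proof.
have /andP[/eqP UU' /eqP U'U] := unitaryP U.
have /andP[/eqP VV' /eqP V'V] := unitaryP V.
rewrite unfold_in adjmxM; apply/andP; split; apply/eqP.
  by rewrite mulmxA -[X in X *m _]mulmxA VV' mulmx1 UU'.
by rewrite mulmxA -[X in X *m _]mulmxA U'U mulmx1 V'V.
Qed.

Definition unitary_mul n (U V : unitary n) : unitary n := Unitary (isunitaryM U V).

Lemma selfadjoint_conj n (U : unitary n) (A : herm n) :
  U *m A *m adjmx U \in @selfadjoint n.
Proof.
have /eqP hA := hermP A.
by rewrite unfold_in !adjmxM adjmxK hA mulmxA.
Qed.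

Definition herm_conj n (U : unitary n) (A : herm n) : herm n :=
  Herm (selfadjoint_conj U A).

Lemma selfadjoint_pid n r : pid_mx r \in @selfadjoint n.
Proof. by rewrite unfold_in adjmx_pid. Qed.

Definition herm_pid n r : herm n := Herm (selfadjoint_pid n r).

(* k-th real coordinate of the entry (i, j) *)
Definition mx_coord n (i j : 'I_n) (k : 'I_(\dim {:K})) (A : 'M[K]_n) : R :=
  coord (vbasis {:K}) k (A i j).

(* generators of the Borel sigma-algebra of a space T of matrices; that
   sigma-algebra does not depend on the basis used in mx_coord *)
Definition coord_cylinders T n (f : T -> 'M[K]_n) : set (set T) :=
  [set C | exists i j k (B : set R),
     measurable B /\ C = (fun x => mx_coord i j k (f x)) @^-1` B].

HB.instance Definition _ n :=
  Measurable.copy (herm n) (g_sigma_algebraType (coord_cylinders (@herm_mx n))).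

HB.instance Definition _ n := Measurable.copy (unitary n)
  (g_sigma_algebraType (coord_cylinders (@unitary_mx n))).

End hermitian_and_unitary.

Section independence_and_conditioning.
Variables (R : realType) (d : measure_display) (Omega : measurableType d).
Variable P : probability Omega R.
Local Open Scope ereal_scope.

Definition independent_systems (F G : set (set Omega)) : Prop :=
  forall A B, F A -> G B -> P (A `&` B) = P A * P B.

Definition independent_rv d1 d2 (T1 : measurableType d1) (T2 : measurableType d2)
    (X : Omega -> T1) (Y : Omega -> T2) : Prop :=
  independent_systems (g_sigma_algebra_preimage X) (g_sigma_algebra_preimage Y).

Definition independent_seq d1 (T : measurableType d1) (X : nat -> Omega -> T) :
    Prop :=
  forall (J : seq nat) (B : nat -> set T), uniq J ->
    (forall j, measurable (B j)) ->
    P (\bigcap_(j in [set` J]) (X j @^-1` B j)) = \prod_(j <- J) P (X j @^-1` B j).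

Definition sigma_algebra_seq d1 (T : measurableType d1) (X : nat -> Omega -> T) :
    set (set Omega) :=
  <<s \bigcup_k g_sigma_algebra_preimage (X k) >>.

(* W is a version of E(Z | S), for Z and W with values in a space of matrices:
   integrability and integrals are taken entrywise and coordinatewise *)
Definition is_cond_expectation d1 (T : measurableType d1) (K : starAlgType R) n
    (Z : Omega -> 'M[K]_n) (S : Omega -> T) (W : Omega -> 'M[K]_n) : Prop :=
  forall i j k,
    let z w := mx_coord i j k (Z w) in
    let v w := mx_coord i j k (W w) in
    [/\ P.-integrable [set: Omega] (EFin \o z),
        P.-integrable [set: Omega] (EFin \o v),
        forall B : set R, measurable B -> g_sigma_algebra_preimage S (v @^-1` B) &
        forall A, g_sigma_algebra_preimage S A ->
          \int[P]_(w in A) (z w)%:E = \int[P]_(w in A) (v w)%:E].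

End independence_and_conditioning.

Section ensembles.
Variables (R : realType) (K : starAlgType R) (n : nat).
Local Notation H := (herm K n).

Definition is_haar (haar : probability (unitary K n) R) : Prop :=
  forall (V : unitary K n) (B : set (unitary K n)), measurable B ->
    haar (unitary_mul V @^-1` B) = haar B.

Definition rotation_invariant (mu : probability H R) : Prop :=
  forall (U : unitary K n) (B : set H), measurable B ->
    mu (herm_conj U @^-1` B) = mu B.

Definition finite_second_moments (mu : probability H R) : Prop :=
  forall i j k, (\int[mu]_(A in [set: H]) ((mx_coord i j k A) ^+ 2)%:E < +oo)%E.

(* a%:A is the real number a seen as an element of the R-algebra K *)
Definition meixner (mu : probability H R) (a b c : R) : Prop :=
  [/\ rotation_invariant mu,
      finite_second_moments mu &
      forall d (Omega : measurableType d) (P : probability Omega R)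
             (X Y : {RV P >-> H}),
        (forall B, measurable B -> distribution P X B = mu B) ->
        (forall B, measurable B -> distribution P Y B = mu B) ->
        independent_rv P X Y ->
        is_cond_expectation P
          (fun w => (X w - Y w : 'M[K]_n) ^+ 2)
          (X \+ Y)
          (fun w => a%:A *: (X w + Y w : 'M[K]_n) ^+ 2
                    + b%:A *: (X w + Y w : 'M[K]_n) + (c%:A)%:M)].

Section with_haar.
Variable haar : probability (unitary K n) R.

(* law of U I_{m,n} U^* *)
Definition projection_law (m : nat) : set H -> \bar R :=
  pushforward haar (fun U : unitary K n => herm_conj U (herm_pid K n m)).

(* q i is the weight of the law of projections of rank i.+1; for i.+1 = n the
   latter is the Dirac mass at the identity, see projection_lawT *)
Definition bernoulli_law (q : 'I_n -> R) (B : set H) : \bar R :=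
  ((1 - \sum_i q i)%:E * \d_(0%R : H) B
   + \sum_(i < n) (q i)%:E * projection_law i.+1 B)%E.

Definition poisson_ensemble (lambda : 'I_n -> R) (mu : probability H R) : Prop :=
  let total := \sum_i lambda i in
  exists d (Omega : measurableType d) (P : probability Omega R)
         (N : {RV P >-> nat}) (X : nat -> {RV P >-> H}),
    [/\ forall k, distribution P N [set k] = (poisson_pmf total k)%:E,
        forall k (B : set H), measurable B ->
          distribution P (X k) B = bernoulli_law (fun i => lambda i / total) B,
        independent_seq P X,
        independent_systems P (g_sigma_algebra_preimage N) (sigma_algebra_seq X) &
        forall B : set H, measurable B ->
          mu B = pushforward P (fun w => \sum_(k < N w) X k w) B].

Lemma projection_lawT (B : set H) :
  projection_law n B = \d_(herm_pid K n n : H) B /\ herm_pid K n n = 1%:M :> 'M[K]_n.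
Proof.
split; last by rewrite /= pid_mx_1.
rewrite /projection_law /pushforward (_ : (fun _ => _) = cst (herm_pid K n n)).
  rewrite preimage_cst diracE; case: ifP => _; first exact: probability_setT.
  exact: measure0.
apply/funext => U; apply: val_inj; have /andP[/eqP UU' _] := unitaryP U.
by rewrite /= pid_mx_1 mulmx1 UU'.
Qed.

End with_haar.
End ensembles.

(* Main.v *)
(* The law mu of the Poisson ensemble is compound Poisson with jump law nu carried
   by the projections z^2 = z, so it satisfies Mecke's identity
     E[p(X) f(X)] = lam E[int p(z) f(X + z) nu(dz)]
   for functionals p that are additive and nonnegative on projections.  For
   independent copies X, Y of law mu, S = X + Y and D = X - Y, applying it to each
   variable gives
     E[p(D) q(D) 1_A(S)] = 2 lam int p(z) q(z) Pr(S + z in A) nu(dz),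
     E[p(S) 1_A(S)] = 2 lam int p(z) Pr(S + z in A) nu(dz).
   Coordinates are differences of functionals nonnegative on projections, being
   dominated by the trace there.  Hence the first identity computes the
   coordinates of E[D^2 1_A(S)], and as z^2 = z on the jumps the result agrees
   with the second. *)
Require Import Defs.
From HB Require Import structures.
From mathcomp Require Import all_boot all_order all_algebra.
From mathcomp Require Import all_classical all_reals all_analysis.
From mathcomp Require Import measurable_realfun complex.
From mathcomp Require Import ring lra.
Set Implicit Arguments.
Unset Strict Implicit.
Unset Printing Implicit Defensive.
Import Order.TTheory GRing.Theory Num.Theory.
Local Open Scope classical_set_scope.
Local Open Scope ring_scope.

(** A nonzero additive functional takes both signs on Hermitian matrices; its sign is known only
    where the jumps live, and additivity carries it, almost surely, to sums of jumps. Mecke's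
    identity is therefore proved for absolute values, as an identity between integrals in [0, +oo]:
    Tonelli then applies before any moment of [mu] is known to be finite. Absolute values are
    removed off null sets, and finiteness comes from bounds on projections. The quadratic identity
    rests on the difference E[p(X) q(X) 1_A(S)] - E[p(X) q(Y) 1_A(S)]. Once a jump z is split off
    from X by Mecke's identity for p, the first integrand contains q(X) + q(z) and the second q(Y).
    The event now concerns X + Y + z, which is symmetric in X and Y, so q(X) and q(Y) cancel and
    only q(z) survives. The factor 2 lam counts the two variables; it is the same in the linear and
    the quadratic identity, which is why B = 1. *)

Section linear_coordinates.
Variables (R : realType) (K : starAlgType R).

(** * Real-linear functionals on the scalar algebra *)

Definition real_linear (phi : K -> R) : Prop :=
  forall a x y, phi (a *: x + y) = a * phi x + phi y.

Lemma real_linear0 phi : real_linear phi -> phi 0 = 0.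
Proof.
by move=> L; move: (L (-1) 0 0); rewrite scaler0 add0r mulN1r addNr.
Qed.

Lemma real_linearD phi : real_linear phi -> {morph phi : x y / x + y}.
Proof. by move=> L x y; rewrite -[x in LHS]scale1r L mul1r. Qed.

Lemma real_linearZ phi a x : real_linear phi -> phi (a *: x) = a * phi x.
Proof. by move=> L; rewrite -[a *: x]addr0 L (real_linear0 L) addr0. Qed.

Lemma real_linear_sum phi I (r : seq I) (P : pred I) (F : I -> K) :
  real_linear phi ->
  phi (\sum_(i <- r | P i) F i) = \sum_(i <- r | P i) phi (F i).
Proof. by move=> L; apply: (big_morph _ (real_linearD L) (real_linear0 L)). Qed.

Lemma real_linear_coord k : real_linear (coord (vbasis {:K}) k).
Proof. by move=> a x y; rewrite linearP. Qed.

Lemma real_linear_expand phi x : real_linear phi ->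
  phi x = \sum_(k < \dim {:K}) coord (vbasis {:K}) k x * phi (vbasis {:K})`_k.
Proof.
move=> L; rewrite {1}(coord_vbasis (memvf x)) (real_linear_sum _ _ _ L).
by apply: eq_bigr => k _; rewrite real_linearZ.
Qed.

(** Structure constants make each coordinate of a product a polynomial in the coordinates of the
    factors. This serves both the measurability of products and the entries of a squared matrix. *)
Lemma real_linear_mul phi x y : real_linear phi ->
  phi (x * y) = \sum_(a < \dim {:K}) \sum_(b < \dim {:K})
    phi ((vbasis {:K})`_a * (vbasis {:K})`_b) *
    (coord (vbasis {:K}) a x * coord (vbasis {:K}) b y).
Proof.
move=> L.
have Ll z : real_linear (fun x => phi (x * z)).
  by move=> a u v; rewrite mulrDl -scalerAl L.
have Lr z : real_linear (fun x => phi (z * x)).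
  by move=> a u v; rewrite mulrDr -scalerAr L.
rewrite (real_linear_expand x (Ll y)); apply: eq_bigr => a _.
rewrite (real_linear_expand y (Lr _)) mulr_sumr; apply: eq_bigr => b _.
by rewrite mulrA mulrC.
Qed.

End linear_coordinates.

(** * Measurability of algebra-valued maps *)

Section algebra_valued_measurability.
Variables (R : realType) (K : starAlgType R).
Context d (T : measurableType d).

(** [K] carries no sigma-algebra here; measurability by coordinates fits the generators
    [coord_cylinders] of the matrix spaces. *)
Definition kmeasurable (f : T -> K) : Prop :=
  forall k, measurable_fun [set: T] (fun x => coord (vbasis {:K}) k (f x)).

Lemma kmeasurable_linear phi f : real_linear phi -> kmeasurable f ->
  measurable_fun [set: T] (phi \o f).
Proof.
move=> L mf; rewrite (_ : _ \o _ = fun x => \sum_(k < \dim {:K})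
  coord (vbasis {:K}) k (f x) * phi (vbasis {:K})`_k).
  by apply: measurable_sum => k; apply: measurable_funM => //; exact: mf.
by apply/funext => x /=; rewrite -real_linear_expand.
Qed.

Lemma kmeasurable_cst c : kmeasurable (fun=> c).
Proof. by move=> k; exact: measurable_cst. Qed.

Lemma kmeasurableD f g : kmeasurable f -> kmeasurable g ->
  kmeasurable (fun x => f x + g x).
Proof.
move=> mf mg k; under eq_fun do rewrite linearD.
by apply: measurable_funD; [exact: mf|exact: mg].
Qed.

Lemma kmeasurableN f : kmeasurable f -> kmeasurable (fun x => - f x).
Proof.
move=> mf k; under eq_fun do rewrite linearN.
by apply: measurableT_comp; [exact: oppr_measurable|exact: mf].
Qed.

Lemma kmeasurable_sum I (r : seq I) (f : I -> T -> K) :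
  (forall i, kmeasurable (f i)) -> kmeasurable (fun x => \sum_(i <- r) f i x).
Proof.
move=> mf k; under eq_fun do rewrite linear_sum.
by apply: measurable_sum => i; exact: mf.
Qed.

Lemma kmeasurableM f g : kmeasurable f -> kmeasurable g ->
  kmeasurable (fun x => f x * g x).
Proof.
move=> mf mg k; under eq_fun do rewrite (real_linear_mul _ _ (real_linear_coord k)).
apply: measurable_sum => a; apply: measurable_sum => b.
apply: measurable_funM => //; apply: measurable_funM; [exact: mf|exact: mg].
Qed.

Lemma kmeasurable_star f : kmeasurable f -> kmeasurable (fun x => star (f x)).
Proof.
move=> mf k.
apply: (kmeasurable_linear (phi := fun x => coord (vbasis {:K}) k (star x))) => //.
by move=> a x y; rewrite starD starZ linearP.
Qed.

Lemma measurable_eq_zero f : kmeasurable f -> measurable [set x | f x = 0].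
Proof.
move=> mf.
rewrite (_ : [set x | _] = \bigcap_(k in [set: 'I_(\dim {:K})])
    ((fun x => coord (vbasis {:K}) k (f x)) @^-1` [set 0])).
  apply: fin_bigcap_measurable => [|k _]; first exact: finite_finset.
  by rewrite -[X in measurable X]setTI; apply: mf.
apply/seteqP; split => [x /= fx0 k _ /=|x fx]; first by rewrite fx0 linear0.
rewrite /= (coord_vbasis (memvf (f x))) big1// => k _.
by rewrite (fx k I) scale0r.
Qed.

End algebra_valued_measurability.

(** * Measurability of Hermitian and unitary matrix operations *)

Section hermitian_measurability.
Variables (R : realType) (K : starAlgType R) (n : nat).
Local Notation H := (herm K n).

Lemma mx_coordD i j k : {morph (fun A : 'M[K]_n => mx_coord i j k A) : A B / A + B}.
Proof. by move=> A B; rewrite /mx_coord mxE linearD. Qed.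

Lemma measurable_mx_coord i j k :
  measurable_fun [set: H] (fun A : H => mx_coord i j k A).
Proof.
move=> _ B mB; rewrite setTI; apply: sub_sigma_algebra.
by exists i, j, k, B.
Qed.

Lemma measurable_mx_coord_unitary i j k :
  measurable_fun [set: unitary K n] (fun A : unitary K n => mx_coord i j k A).
Proof.
move=> _ B mB; rewrite setTI; apply: sub_sigma_algebra.
by exists i, j, k, B.
Qed.

Context d (T : measurableType d).

Lemma measurable_hermP (f : T -> H) :
  (forall i j, kmeasurable (fun x => herm_mx (f x) i j)) -> measurable_fun [set: T] f.
Proof.
move=> mf; apply: (measurability (coord_cylinders (@herm_mx R K n))) => //.
move=> _ [_ [i [j [k [B [mB ->]]]]] <-].
exact: mf.
Qed.

Lemma kmeasurable_herm (f : T -> H) i j : measurable_fun [set: T] f ->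
  kmeasurable (fun x => herm_mx (f x) i j).
Proof.
move=> mf k.
by apply: (measurableT_comp (f := fun A : H => mx_coord i j k A)) => //;
  exact: measurable_mx_coord.
Qed.

Lemma measurable_hermD (f g : T -> H) : measurable_fun [set: T] f ->
  measurable_fun [set: T] g -> measurable_fun [set: T] (fun x => f x + g x).
Proof.
move=> mf mg; apply: measurable_hermP => i j.
under eq_fun do rewrite mxE.
by apply: kmeasurableD; exact: kmeasurable_herm.
Qed.

Lemma measurable_herm_sum (f : nat -> T -> H) m :
  (forall i, measurable_fun [set: T] (f i)) ->
  measurable_fun [set: T] (fun x => \sum_(i < m) f i x).
Proof.
move=> mf; elim: m => [|m IHm].
  by under eq_fun do rewrite big_ord0; exact: measurable_cst.
by under eq_fun do rewrite big_ord_recr; exact: measurable_hermD.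
Qed.

Lemma measurable_herm_conj (f : T -> H) U : measurable_fun [set: T] f ->
  measurable_fun [set: T] (fun x => herm_conj U (f x)).
Proof.
move=> mf; apply: measurable_hermP => i j /=.
under eq_fun do rewrite mxE.
apply: kmeasurable_sum => l; apply: kmeasurableM; last exact: kmeasurable_cst.
under eq_fun do rewrite mxE.
apply: kmeasurable_sum => m; apply: kmeasurableM; first exact: kmeasurable_cst.
exact: kmeasurable_herm.
Qed.

End hermitian_measurability.

Section unitary_measurability.
Variables (R : realType) (K : starAlgType R) (n : nat).

Lemma measurable_conj_unitary (A : herm K n) :
  measurable_fun [set: unitary K n] (fun U => herm_conj U A).
Proof.
have mU i j : kmeasurable (fun U : unitary K n => unitary_mx U i j).
  by move=> k; exact: measurable_mx_coord_unitary.
apply: measurable_hermP => i j /=.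
under eq_fun do rewrite mxE.
apply: kmeasurable_sum => l; apply: kmeasurableM.
  under eq_fun do rewrite mxE.
  apply: kmeasurable_sum => m; apply: kmeasurableM => //; exact: kmeasurable_cst.
by under eq_fun do rewrite !mxE; apply: kmeasurable_star.
Qed.

Lemma measurable_idempotent : measurable [set A : herm K n | A *m A = A].
Proof.
pose f i j (A : herm K n) : K := (A *m A - A : 'M[K]_n) i j.
rewrite (_ : [set A | _] =
  \bigcap_(ij in [set: 'I_n * 'I_n]) [set A | f ij.1 ij.2 A = 0]).
  apply: fin_bigcap_measurable => [|[i j] _]; first exact: finite_finset.
  apply: measurable_eq_zero; rewrite /f.
  under eq_fun do rewrite !mxE.
  have mH a b : kmeasurable (fun A : herm K n => herm_mx A a b).
    exact: kmeasurable_herm.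
  apply: kmeasurableD; last exact: kmeasurableN.
  by apply: kmeasurable_sum => l; apply: kmeasurableM.
apply/seteqP; split => [A /= AA [i j] _ /=|A fA]; rewrite /f.
  by rewrite AA subrr mxE.
apply/matrixP => i j; apply/eqP; rewrite -subr_eq0; apply/eqP.
by have := fA (i, j) I; rewrite /f /= !mxE.
Qed.

End unitary_measurability.

(** * Product measures and joint laws *)

Section product_law.
Context d1 d2 (T1 : measurableType d1) (T2 : measurableType d2) (R : realType).
Local Open Scope ereal_scope.

(** The constant [c] allows for joint laws restricted to an event, which are no longer
    probabilities; see [psum_step]. *)
Lemma product_measure_unique_scale (m1 : probability T1 R) (m2 : probability T2 R)
    (Q : {measure set (T1 * T2) -> \bar R}) (c : {nonneg R}) :
  (forall A B, measurable A -> measurable B ->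
    Q (A `*` B) = c%:num%:E * (m1 A * m2 B)) ->
  forall X, measurable X -> Q X = c%:num%:E * (m1 \x m2) X.
Proof.
move=> QE X mX.
pose m2' : {finite_measure set T2 -> \bar R} := mscale c m2.
(* Both [Q] and the scaled product agree on rectangles with the product of [m1] and [c] times
   [m2]. *)
rewrite -(@product_measure_unique _ _ _ _ R m1 m2' Q _ X mX); last first.
  by move=> A B mA mB; rewrite QE// /m2' /mscale/= muleCA.
pose Q' : {measure set (T1 * T2) -> \bar R} := mscale c (m1 \x m2)%E.
rewrite (@product_measure_unique _ _ _ _ R m1 m2' Q' _ X mX)//.
move=> A B mA mB; rewrite -[LHS]/(c%:num%:E * (m1 \x m2) (A `*` B)).
by rewrite product_measure1E// muleCA.
Qed.

Lemma product_measure_eq (m1 m1' : probability T1 R) (m2 m2' : probability T2 R) :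
  (forall A, measurable A -> m1 A = m1' A) ->
  (forall B, measurable B -> m2 B = m2' B) ->
  forall X, measurable X -> (m1 \x m2) X = (m1' \x m2') X.
Proof.
move=> E1 E2 X mX.
pose Q' : {measure set (T1 * T2) -> \bar R} := (m1' \x m2')%E.
apply: (@product_measure_unique _ _ _ _ R m1 m2 Q' _ X mX) => A B mA mB.
rewrite -[LHS]/((m1' \x m2') (A `*` B)) product_measure1E//.
by congr (_ * _); apply: esym; [exact: E1|exact: E2].
Qed.

Lemma joint_law d (Omega : measurableType d) (P : probability Omega R)
    (X : {mfun Omega >-> T1}) (Y : {mfun Omega >-> T2}) :
  independent_rv P X Y ->
  forall C, measurable C -> P [set w | C (X w, Y w)] =
    (distribution P X \x distribution P Y)%E C.
Proof.
move=> indXY C mC.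
have mXY : measurable_fun [set: Omega] (fun w => (X w, Y w)).
  exact: measurable_fun_pair.
pose Q := measure_function_pushforward__canonical__measure_function_Measure P mXY.
rewrite (@product_measure_unique _ _ _ _ R (distribution P X) (distribution P Y) Q)//.
move=> A B mA mB; rewrite /Q /= /pushforward /=.
by apply: indXY; [exists A|exists B] => //; rewrite setTI.
Qed.

End product_law.

(** * Partial sums of independent jumps *)

Section sum_law.
Variables (R : realType) (K : starAlgType R) (n : nat).
Local Notation H := (herm K n).
Context d (Omega : measurableType d) (P : probability Omega R).
Variable X : nat -> {RV P >-> H}.
Local Open Scope ereal_scope.

Definition psum m (w : Omega) : H := (\sum_(k < m) (X k w : H))%R.

Lemma measurable_psum m : measurable_fun [set: Omega] (psum m).
Proof.
by apply: (measurable_herm_sum (f := fun k w => X k w)) => k.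
Qed.

HB.instance Definition _ m :=
  isMeasurableFun.Build _ _ Omega H (psum m) (measurable_psum m).

Definition psum_law m : probability H R := distribution P (psum m : {RV P >-> H}).

Lemma psumS m w : psum m.+1 w = (psum m w + X m w)%R.
Proof. by rewrite /psum big_ord_recr. Qed.

Lemma measurable_hermD_pair :
  measurable_fun [set: H * H] (fun z => z.1 + z.2)%R.
Proof. by apply: measurable_hermD. Qed.

Lemma measurable_cylinder (J : seq nat) (B : nat -> set H) :
  (forall j, measurable (B j)) ->
  measurable (\bigcap_(j in [set` J]) (X j @^-1` B j)).
Proof.
move=> mB; apply: fin_bigcap_measurable => [|j _]; first exact: finite_seq.
exact: measurable_funPTI.
Qed.

Hypothesis indX : independent_seq P X.

Let addI (A : set H) := [set z : H * H | A (z.1 + z.2)%R].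

Let measurable_addI A : measurable A -> measurable (addI A).
Proof.
by move=> mA; rewrite -[X in measurable X]setTI; apply: measurable_hermD_pair.
Qed.

(** Restrict [P] to the event [E] on the later variables. On rectangles the image of this
    restriction under the pair ([psum m], [X m]) is a product law times a constant, hence on all
    measurable sets, in particular on [addI A]. The induction hypothesis of [psum_independent]
    appears as a premise so that the case of empty [J], which identifies the law of [psum m.+1], can
    be drawn from it before the induction is complete. *)
Lemma psum_step m (J : seq nat) (B : nat -> set H) A :
  (forall (I : seq nat) (C : nat -> set H) A, uniq I -> all (leq m) I ->
    (forall j, measurable (C j)) -> measurable A ->
    P ((psum m @^-1` A) `&` \bigcap_(j in [set` I]) (X j @^-1` C j)) =
    psum_law m A * \prod_(j <- I) P (X j @^-1` C j)) ->
  uniq J -> all (leq m.+1) J ->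
  (forall j, measurable (B j)) -> measurable A ->
  P ((psum m.+1 @^-1` A) `&` \bigcap_(j in [set` J]) (X j @^-1` B j)) =
  (psum_law m \x distribution P (X m)) (addI A) *
    \prod_(j <- J) P (X j @^-1` B j).
Proof.
move=> IHm uJ mJ mB mA.
set E := \bigcap_(j in _) _.
have mE : measurable E by exact: measurable_cylinder.
have mf : measurable_fun [set: Omega] (fun w => (psum m w, X m w)).
  by apply: measurable_fun_pair; [exact: measurable_psum|exact: measurable_funPT].
pose Q := measure_function_pushforward__canonical__measure_function_Measure
  (mrestr P mE) mf.
have c0 : (0 <= fine (\prod_(j <- J) P (X j @^-1` B j)))%R.
  by rewrite fine_ge0// prode_ge0.
have cE : (NngNum c0)%:num%:E = \prod_(j <- J) P (X j @^-1` B j).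
  rewrite /= fineK// prode_fin_num// => j _.
  by apply: fin_num_measure; exact: measurable_funPTI.
have := @product_measure_unique_scale _ _ _ _ _ (psum_law m) (distribution P (X m)) Q
  (NngNum c0).
rewrite cE muleC => <- //; last exact: measurable_addI.
  rewrite /Q/= /pushforward /mrestr/=; congr (P (_ `&` _)).
  by apply/seteqP; split => w /=; rewrite psumS.
move=> C D mC mD; rewrite /Q/= /pushforward/= /mrestr/=.
have mJm : all (leq m) (m :: J).
  by rewrite /= leqnn; apply: sub_all mJ => j /ltnW.
have umJ : uniq (m :: J).
  rewrite /= uJ andbT; apply/negP => /(allP mJ); by rewrite ltnn.
(* [X m] joins the list of later variables with target [D]; [m] is not in [J], whose entries exceed
   [m]. *)
pose B' j := if j == m then D else B j.
have mB' j : measurable (B' j) by rewrite /B'; case: ifP.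
have neq j : j \in J -> (j == m) = false.
  by move=> jJ; apply/eqP => jm; move: (allP mJ _ jJ); rewrite jm ltnn.
have := IHm _ B' C umJ mJm mB' mC.
have B'm : B' m = D by rewrite /B' eqxx.
rewrite big_cons B'm => IH.
rewrite (_ : _ `&` _ =
   psum m @^-1` C `&` \bigcap_(j in [set` m :: J]) (X j @^-1` B' j)).
  rewrite IH /= muleA muleC; congr (_ * _).
  by rewrite big_seq [RHS]big_seq; apply: eq_bigr => j jJ; rewrite /B' neq.
apply/seteqP; split => w /=.
  move=> [[Cw Dw] Ew]; split => // j /=; rewrite inE => /orP[/eqP ->|jJ].
    by rewrite /B' eqxx.
  by rewrite /B' neq//; exact: Ew.
move=> [Cw Ew]; split; first split => //.
  by have := Ew m; rewrite /= /B' eqxx; apply; rewrite mem_head.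
by move=> j /= jJ; have := Ew j; rewrite /= /B' neq//; apply; rewrite inE jJ orbT.
Qed.

Lemma psum_lawS_setT m A :
  (forall (I : seq nat) (C : nat -> set H) A, uniq I -> all (leq m) I ->
    (forall j, measurable (C j)) -> measurable A ->
    P ((psum m @^-1` A) `&` \bigcap_(j in [set` I]) (X j @^-1` C j)) =
    psum_law m A * \prod_(j <- I) P (X j @^-1` C j)) ->
  measurable A ->
  psum_law m.+1 A = (psum_law m \x distribution P (X m)) (addI A).
Proof.
move=> IHm mA.
have := @psum_step m [::] (fun=> setT) A IHm isT isT (fun=> measurableT) mA.
rewrite big_nil mule1 => <-; congr (P _).
by rewrite set_nil bigcap_set0 setIT.
Qed.

(* The later variables are carried along: the induction adds X m to psum m
   while keeping the X j with m < j. *)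
Lemma psum_independent m (J : seq nat) (B : nat -> set H) A :
  uniq J -> all (leq m) J -> (forall j, measurable (B j)) -> measurable A ->
  P ((psum m @^-1` A) `&` \bigcap_(j in [set` J]) (X j @^-1` B j)) =
  psum_law m A * \prod_(j <- J) P (X j @^-1` B j).
Proof.
elim: m J B A => [|m IHm] J B A uJ mJ mB mA; last first.
  by rewrite psum_step// psum_lawS_setT.
have S0 : psum 0 = cst 0%R by apply/funext => w; rewrite /psum big_ord0.
have -> : psum_law 0 A = P (psum 0 @^-1` A) by [].
rewrite S0 preimage_cst.
case: ifP => A0; last first.
  by rewrite set0I !measure0 mul0e.
by rewrite setTI probability_setT mul1e indX.
Qed.

Lemma psum_lawS m A : measurable A ->
  psum_law m.+1 A = (psum_law m \x distribution P (X m)) (addI A).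
Proof. by move=> mA; apply: psum_lawS_setT => // *; exact: psum_independent. Qed.

End sum_law.

(** * The Poisson sum as a mixture of the laws of partial sums *)

Section random_sum.
Variables (R : realType) (K : starAlgType R) (n : nat).
Local Notation H := (herm K n).
Context d (Omega : measurableType d) (P : probability Omega R).
Variables (X : nat -> {RV P >-> H}) (N : {RV P >-> nat}).
Local Open Scope ereal_scope.

Lemma sigma_algebra_seq_psum m (B : set H) : measurable B ->
  sigma_algebra_seq (fun k => X k : Omega -> H) (psum X m @^-1` B).
Proof.
(* The sample space with the sigma-algebra generated by the whole sequence: the claim is
   measurability of [psum X m] on it. *)
pose T' := g_sigma_algebraType (\bigcup_k g_sigma_algebra_preimage (X k : Omega -> H)).
have mX k : measurable_fun [set: T'] (X k : T' -> H).
  move=> _ C mC; rewrite setTI; apply: sub_sigma_algebra; exists k => //.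
  by exists C => //; rewrite setTI.
have mS : measurable_fun [set: T'] (psum X m : T' -> H).
  exact: (@measurable_herm_sum _ _ _ _ T' (fun k => X k : T' -> H)).
by move=> mB; have := mS measurableT B mB; rewrite setTI.
Qed.

Lemma random_sum_law (B : set H) : measurable B ->
  independent_systems P (g_sigma_algebra_preimage (N : Omega -> nat))
    (sigma_algebra_seq (fun k => X k : Omega -> H)) ->
  P [set w | B (psum X (N w) w)] =
    \sum_(m <oo) (P (N @^-1` [set m]) * psum_law X m B).
Proof.
move=> mB indN.
pose F m := (N @^-1` [set m]) `&` (psum X m @^-1` B).
have mF m : measurable (F m).
  by apply: measurableI; [exact: measurable_funPTI|
    rewrite -[X in measurable X]setTI; exact: measurable_psum].
rewrite (_ : [set w | _] = \bigcup_m F m).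
  rewrite measure_semi_bigcup//; last exact: bigcupT_measurable.
    apply: eq_eseriesr => m _; apply: indN; first by exists [set m] => //; rewrite setTI.
    exact: sigma_algebra_seq_psum.
  apply/trivIsetP => i j _ _ /eqP ij; apply/seteqP; split => // w.
  by move=> [[/= Ni _] [/= Nj _]]; case: ij; rewrite -Ni -Nj.
by apply/seteqP; split => [w Bw|w [m _ [/= ->]]//]; exists (N w).
Qed.

End random_sum.

(** * Integrals up to null sets and against mixtures *)

Section null_sets.
Context d (T : measurableType d) (R : realType) (m : {measure set T -> \bar R}).
Local Open Scope ereal_scope.

Lemma ge0_integral_null_eq (N : set T) (f g : T -> \bar R) :
  measurable N -> m N = 0 ->
  measurable_fun [set: T] f -> measurable_fun [set: T] g ->
  (forall x, 0 <= f x) -> (forall x, 0 <= g x) ->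
  (forall x, ~ N x -> f x = g x) -> \int[m]_x f x = \int[m]_x g x.
Proof.
move=> mN N0 mf mg f0 g0 fg; apply: ge0_ae_eq_integral => //.
exists N; split => // x /= h; apply: contrapT => Nx; apply: h => _.
exact: fg.
Qed.

Lemma integral_mixture (w : nat -> {nonneg R}) (Q : nat -> {measure set T -> \bar R})
    (f : T -> \bar R) :
  (forall A, measurable A -> m A = \sum_(k <oo) ((w k)%:num%:E * Q k A)) ->
  measurable_fun [set: T] f -> (forall x, 0 <= f x) ->
  \int[m]_x f x = \sum_(k <oo) ((w k)%:num%:E * \int[Q k]_x f x).
Proof.
move=> mE mf f0.
pose M k : {measure set T -> \bar R} := mscale (w k) (Q k).
rewrite (@eq_measure_integral _ _ _ _ (mseries M 0)); last first.
  by move=> A mA _; rewrite mE.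
rewrite ge0_integral_measure_series//.
by apply: eq_eseriesr => k _; rewrite /M ge0_integral_mscale.
Qed.

End null_sets.

Section product_null_sets.
Context d (T : measurableType d) (R : realType) (m1 m2 : probability T R).
Local Open Scope ereal_scope.

Lemma product_null_set (N : set T) : measurable N -> m1 N = 0 -> m2 N = 0 ->
  (m1 \x m2) (N `*` setT `|` setT `*` N) = 0.
Proof.
move=> mN N1 N2; apply/eqP; rewrite eq_le measure_ge0 andbT.
apply: le_trans (measureU2 _ _ _) _; [exact: measurableX|exact: measurableX|].
rewrite -[X in X + _]/((m1 \x m2) (N `*` setT)) -[X in _ + X]/((m1 \x m2) (setT `*` N)).
rewrite !product_measure1E//.
by rewrite [X in X * _]N1 [X in _ + _ * X]N2 mul0e mule0 adde0.
Qed.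

End product_null_sets.

(** * Mecke's identity for the compound Poisson law *)

Section mecke.
Variables (R : realType) (K : starAlgType R) (n : nat).
Local Notation H := (herm K n).
Variables (T : nat -> probability H R) (nu : probability H R).
Local Open Scope ereal_scope.

Let addI (A : set H) := [set z : H * H | A (z.1 + z.2)%R].

Hypothesis T0E : forall A, measurable A -> T 0 A = \d_(0%R : H) A.
Hypothesis TSE : forall m A, measurable A -> T m.+1 A = (T m \x nu) (addI A).

(* Sign conditions hold only almost surely, so the integrals below are written
   with absolute values. *)
Definition nonneg_functional (p : H -> R) : Prop :=
  [/\ measurable_fun [set: H] p, {morph p : x y / (x + y)%R} &
      nu [set z | (p z < 0)%R] = 0].

Lemma morph0 (p : H -> R) : {morph p : x y / (x + y)%R} -> p 0%R = 0%R.
Proof. by move=> pD; apply: (@addrI _ (p 0%R)); rewrite -pD !addr0. Qed.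

Lemma measurable_negative_set d (S : measurableType d) (p : S -> R) :
  measurable_fun [set: S] p -> measurable [set x | (p x < 0)%R].
Proof.
move=> mp; rewrite (_ : [set _ | _] = setT `&` p @^-1` `]-oo, 0%R[).
  by apply: mp => //; exact: measurable_itv.
by rewrite setTI; apply/seteqP; split => x /=; rewrite in_itv.
Qed.

Lemma ge0_integral_law0 (f : H -> \bar R) : measurable_fun [set: H] f ->
  \int[T 0]_x f x = f 0%R.
Proof.
move=> mf; rewrite (@eq_measure_integral _ _ _ _ \d_(0%R : H)).
  by rewrite integral_dirac// diracE in_setT mul1e.
by move=> A mA _; exact: T0E.
Qed.

Lemma ge0_integral_lawS m (f : H -> \bar R) : measurable_fun [set: H] f -> (forall x, 0 <= f x) ->
  \int[T m.+1]_x f x = \int[T m]_x \int[nu]_z f (x + z)%R.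
Proof.
move=> mf f0.
rewrite (@eq_measure_integral _ _ _ _
  (measure_function_pushforward__canonical__measure_function_Measure
    (T m \x nu)%E (@measurable_hermD_pair R K n))).
  rewrite ge0_integral_pushforward//=; last exact: measurable_hermD_pair.
  rewrite fubini_tonelli1//.
  apply: measurableT_comp => //; exact: measurable_hermD_pair.
by move=> A mA _; exact: TSE.
Qed.

(** By additivity a negative value of [p] at a sum forces one at a summand, so the sign of [p]
    passes from [nu] to its convolution powers. *)
Lemma null_law p m : nonneg_functional p -> T m [set z | (p z < 0)%R] = 0.
Proof.
move=> [mp pD p0]; have mN := measurable_negative_set mp.
set N := [set z | _] in p0 mN *.
elim: m => [|m IHm].
  by rewrite T0E// diracE /N memNset//= (morph0 pD) ltxx.
apply/eqP; rewrite eq_le measure_ge0 andbT TSE//.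
apply: (@le_trans _ _ ((T m \x nu) (N `*` setT `|` setT `*` N))).
  apply: le_measure; rewrite ?inE.
  - rewrite /addI -[X in measurable X]setTI; exact: measurable_hermD_pair.
  - by apply: measurableU; exact: measurableX.
  - move=> [x z]; rewrite /addI /N /= pD => pxz.
    have [px|px] := ltP (p x) 0%R; [by left|right; split => //].
    by apply: le_lt_trans pxz; rewrite lerDr.
by rewrite product_null_set.
Qed.

Lemma measurable_shift_kernel (p : H -> R) (f : H -> \bar R) : measurable_fun [set: H] p ->
  measurable_fun [set: H] f ->
  measurable_fun [set: H * H] (fun xz => (`|p xz.2|)%:E * f (xz.1 + xz.2)%R).
Proof.
move=> mp mf; apply: emeasurable_funM.
  apply/measurable_EFinP; apply: measurableT_comp => //.
  exact: measurableT_comp.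
by apply: measurableT_comp => //; exact: measurable_hermD_pair.
Qed.

(* By exchangeability each of the m summands contributes the same amount. *)
Lemma mecke_law p (f : H -> \bar R) m : nonneg_functional p -> measurable_fun [set: H] f ->
  (forall x, 0 <= f x) ->
  \int[T m]_x ((`|p x|)%:E * f x) =
  m%:R%:E * \int[T m.-1]_x \int[nu]_z ((`|p z|)%:E * f (x + z)%R).
Proof.
move=> pos_p; have [mp pD p0] := pos_p.
have mabs : measurable_fun [set: H] (fun x => (`|p x|)%:E).
  by apply/measurable_EFinP; exact: measurableT_comp.
have mN := measurable_negative_set mp.
elim: m f => [|m IHm] f mf f0.
  rewrite ge0_integral_law0; last exact: emeasurable_funM.
  by rewrite (morph0 pD) normr0 !mul0e.
have mfD : measurable_fun [set: H * H] (fun xz => f (xz.1 + xz.2)%R).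
  by apply: measurableT_comp => //; exact: measurable_hermD_pair.
have mpf := measurable_shift_kernel mp mf.
pose F (xz : H * H) := (`|p xz.1|)%:E * f (xz.1 + xz.2)%R.
have mF : measurable_fun [set: H * H] F.
  by apply: emeasurable_funM => //; apply: measurableT_comp mabs _.
have F0 xz : 0 <= F xz by rewrite mule_ge0.
pose G (xz : H * H) := (`|p xz.2|)%:E * f (xz.1 + xz.2)%R.
have G0 xz : 0 <= G xz by rewrite mule_ge0.
pose g x := \int[nu]_z f (x + z)%R.
have mg : measurable_fun [set: H] g.
  by apply: (measurable_fun_fubini_tonelli_F (fun xz : H * H => f (xz.1 + xz.2)%R)).
have g0 x : 0 <= g x by apply: integral_ge0.
rewrite ge0_integral_lawS//; [|exact: emeasurable_funM|by move=> x; rewrite mule_ge0].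
(* Off a null set |p(x + z)| = |p x| + |p z|. The first term goes to the induction hypothesis,
   applied to the average [g] of [f] over the last jump; the second is the contribution of the last
   jump itself. *)
transitivity (\int[T m]_x ((`|p x|)%:E * g x) + \int[T m]_x \int[nu]_z G (x, z)).
  transitivity (\int[T m \x nu]_xz (F xz + G xz)).
    rewrite -(fubini_tonelli1 (m1 := T m) (m2 := nu) (fun xz : H * H =>
      (`|p (xz.1 + xz.2)|)%:E * f (xz.1 + xz.2)%R)) => [||xz]; last 1 first.
    - by rewrite mule_ge0.
    - apply: (@ge0_integral_null_eq _ _ _ _
          ([set x | (p x < 0)%R] `*` setT `|` setT `*` [set x | (p x < 0)%R])).
      + by apply: measurableU; exact: measurableX.
      + by apply: product_null_set => //; exact: null_law.
      + apply: emeasurable_funM => //; apply: measurableT_comp mabs _.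
        exact: measurable_hermD_pair.
      + exact: emeasurable_funD.
      + by move=> xz; rewrite mule_ge0.
      + by move=> xz; rewrite adde_ge0.
      + move=> [x z] /= Nxz; rewrite /F /G /= -ge0_muleDl//; congr (_ * _).
        have px : (0 <= p x)%R by rewrite leNgt; apply/negP => px; apply: Nxz; left.
        have pz : (0 <= p z)%R by rewrite leNgt; apply/negP => pz; apply: Nxz; right.
        by rewrite pD !ger0_norm// addr_ge0.
    - apply: emeasurable_funM => //; apply: measurableT_comp mabs _.
      exact: measurable_hermD_pair.
  rewrite ge0_integralD//; congr (_ + _); rewrite fubini_tonelli1//.
  apply: eq_integral => x _; rewrite /fubini_F /F /= ge0_integralZl//.
  by apply: measurableT_comp => //; apply: measurable_hermD.
rewrite IHm// [RHS](_ : _ = m%:R%:E * \int[T m]_x \int[nu]_z G (x, z) +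
    \int[T m]_x \int[nu]_z G (x, z)); last first.
  by rewrite -natr1 EFinD ge0_muleDl ?lee_fin// mul1e.
(* For m = 0 both sides carry the factor 0, so the default value of [0.-1] is harmless. Otherwise
   one more jump is split off from [T m.+1], and Tonelli exchanges it with the jump weighted by
   [p]. *)
congr (_ + _); case: m {IHm} => [|m] in mF mpf *; first by rewrite !mul0e.
congr (_ * _) => /=.
rewrite [RHS](@ge0_integral_lawS m (fun x => \int[nu]_z G (x, z))); first last.
- by move=> x; apply: integral_ge0.
- exact: (measurable_fun_fubini_tonelli_F G).
apply: eq_integral => x _.
have mx2 : measurable_fun [set: H * H] (fun z : H * H => f (x + z.1 + z.2)%R).
  apply: measurableT_comp => //; apply: measurable_hermD => //.
  by apply: measurable_hermD.
transitivity (\int[nu]_z \int[nu]_z' ((`|p z|)%:E * f (x + z + z')%R)).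
  apply: eq_integral => z _; rewrite ge0_integralZl//.
  exact: (measurableT_comp mx2 (pair1_measurable z)).
rewrite (@fubini_tonelli _ _ _ _ _ nu nu (fun z => (`|p z.1|)%:E * f (x + z.1 + z.2)%R)).
- by apply: eq_integral => z' _; apply: eq_integral => z _; rewrite /G /= addrAC.
- by apply: emeasurable_funM => //; apply: measurableT_comp mabs _.
- by move=> z; rewrite mule_ge0.
Qed.

Variables (mu : probability H R) (lam : R).
Hypothesis lam_gt0 : (0 < lam)%R.
Hypothesis muE : forall A, measurable A ->
  mu A = \sum_(m <oo) ((poisson_pmf lam m)%:E * T m A).

Lemma mixture_integral (f : H -> \bar R) : measurable_fun [set: H] f -> (forall x, 0 <= f x) ->
  \int[mu]_x f x = \sum_(m <oo) ((poisson_pmf lam m)%:E * \int[T m]_x f x).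
Proof.
move=> mf f0; apply: (@integral_mixture _ _ _ mu
  (fun m => NngNum (poisson_pmf_ge0 lam m)) (fun m => T m)) => //.
Qed.

Lemma null_mixture p : nonneg_functional p -> mu [set z | (p z < 0)%R] = 0.
Proof.
move=> pos_p; rewrite muE; last by case: pos_p => mp _ _; exact: measurable_negative_set.
by rewrite eseries0// => m _ _; rewrite null_law// mule0.
Qed.

(* The m-th term of the left-hand side is the (m - 1)-st term of the right-hand
   side, because m * poisson_pmf lam m = lam * poisson_pmf lam (m - 1). *)
Lemma mecke p (f : H -> \bar R) : nonneg_functional p -> measurable_fun [set: H] f ->
  (forall x, 0 <= f x) ->
  \int[mu]_x ((`|p x|)%:E * f x) =
  lam%:E * \int[mu]_x \int[nu]_z ((`|p z|)%:E * f (x + z)%R).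
Proof.
move=> pos_p mf f0; have [mp pD p0] := pos_p.
have mabs : measurable_fun [set: H] (fun x => (`|p x|)%:E).
  by apply/measurable_EFinP; exact: measurableT_comp.
pose h x := \int[nu]_z ((`|p z|)%:E * f (x + z)%R).
have h0 x : 0 <= h x by apply: integral_ge0 => z _; rewrite mule_ge0.
have mh : measurable_fun [set: H] h.
  apply: (measurable_fun_fubini_tonelli_F (fun xz : H * H =>
    (`|p xz.2|)%:E * f (xz.1 + xz.2)%R)).
    exact: measurable_shift_kernel.
  by move=> xz; rewrite mule_ge0.
rewrite mixture_integral; [|exact: emeasurable_funM|by move=> x; rewrite mule_ge0].
rewrite (mixture_integral mh h0).
rewrite nneseries_recl => [|m _|//]; last first.
  rewrite mule_ge0 ?lee_fin ?poisson_pmf_ge0//.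
  by apply: integral_ge0 => x _; rewrite mule_ge0.
rewrite (mecke_law 0 pos_p mf f0) mul0e mule0 add0e.
rewrite -(@nneseries_addn _ (fun m => (poisson_pmf lam m)%:E *
    \int[T m]_x ((`|p x|)%:E * f x)) 1); last first.
  move=> m; rewrite mule_ge0 ?lee_fin ?poisson_pmf_ge0//.
  by apply: integral_ge0 => x _; rewrite mule_ge0.
rewrite -nneseriesZl; last first.
  by move=> m _; rewrite mule_ge0 ?lee_fin ?poisson_pmf_ge0//; exact: integral_ge0.
apply: eq_eseriesr => m _; rewrite addn1 mecke_law//= !muleA -!EFinM.
congr (_%:E * _); rewrite /poisson_pmf lam_gt0 exprS factS natrM.
have m1 : (m.+1%:R != 0 :> R)%R by rewrite pnatr_eq0.
have m2 : (m`!%:R != 0 :> R)%R by rewrite pnatr_eq0 -lt0n fact_gt0.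
by field; rewrite m2 nat1r.
Qed.

End mecke.

(** * Mecke's identity for two independent copies *)

Section iid_pair_law.
Context d (T : measurableType d) (R : realType) (mu : probability T R).
Local Open Scope ereal_scope.

Definition iid_pair : probability (T * T)%type R := (mu \x mu)%E.

Lemma iid_pair_integral1 (h : T * T -> \bar R) :
  measurable_fun [set: T * T] h -> (forall w, 0 <= h w) ->
  \int[iid_pair]_w h w = \int[mu]_x \int[mu]_y h (x, y).
Proof. exact: fubini_tonelli1. Qed.

Lemma iid_pair_integral2 (h : T * T -> \bar R) :
  measurable_fun [set: T * T] h -> (forall w, 0 <= h w) ->
  \int[iid_pair]_w h w = \int[mu]_y \int[mu]_x h (x, y).
Proof. exact: fubini_tonelli2. Qed.

Lemma ge0_integral_swap (h : T * T -> \bar R) :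
  measurable_fun [set: T * T] h -> (forall w, 0 <= h w) ->
  \int[iid_pair]_w h (w.2, w.1) = \int[iid_pair]_w h w.
Proof.
move=> mh h0; rewrite [RHS]iid_pair_integral2// iid_pair_integral1//.
by apply: measurableT_comp => //; exact: measurable_fun_pair.
Qed.

End iid_pair_law.

Section pair_mecke.
Variables (R : realType) (K : starAlgType R) (n : nat).
Local Notation H := (herm K n).
Variables (mu nu : probability H R) (lam : R).
Local Open Scope ereal_scope.

Hypothesis lam_gt0 : (0 < lam)%R.
Hypothesis mecke_mu : forall (p : H -> R) (f : H -> \bar R),
  nonneg_functional nu p -> measurable_fun [set: H] f -> (forall x, 0 <= f x) ->
  \int[mu]_x ((`|p x|)%:E * f x) =
  lam%:E * \int[mu]_x \int[nu]_z ((`|p z|)%:E * f (x + z)%R).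
Hypothesis null_mu : forall p : H -> R, nonneg_functional nu p ->
  mu [set z | (p z < 0)%R] = 0.

Lemma measurable_absE d (T : measurableType d) (p : T -> R) :
  measurable_fun [set: T] p -> measurable_fun [set: T] (fun x => (`|p x|)%:E).
Proof. by move=> mp; apply/measurable_EFinP; exact: measurableT_comp. Qed.

(** With the second coordinate frozen this is [mecke_mu] in the first one; Tonelli then moves the
    integral over the jump outside. *)
Lemma mecke_pair p (h : H * H -> \bar R) : nonneg_functional nu p ->
  measurable_fun [set: H * H] h -> (forall w, 0 <= h w) ->
  \int[iid_pair mu]_w ((`|p w.1|)%:E * h w) =
  lam%:E * \int[nu]_z ((`|p z|)%:E * \int[iid_pair mu]_w h ((w.1 + z)%R, w.2)).
Proof.
move=> pos_p mh h0; have [mp pD p0] := pos_p.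
have mabs := measurable_absE mp.
have mhz : measurable_fun [set: H * (H * H)]
    (fun t : H * (H * H) => h ((t.2.1 + t.1)%R, t.2.2)).
  apply: measurableT_comp => //; apply: measurable_fun_pair => /=.
    by apply: measurable_hermD => //; apply: measurableT_comp.
  exact: measurableT_comp.
have mk : measurable_fun [set: H * (H * H)]
    (fun t : H * (H * H) => (`|p t.1|)%:E * h ((t.2.1 + t.1)%R, t.2.2)).
  by apply: emeasurable_funM => //; apply: measurableT_comp mabs _.
transitivity (lam%:E * \int[nu]_z \int[iid_pair mu]_w
    ((`|p z|)%:E * h ((w.1 + z)%R, w.2))); last first.
  congr (_ * _); apply: eq_integral => z _; rewrite ge0_integralZl//.
  exact: (measurableT_comp mhz (pair1_measurable z)).
rewrite (@fubini_tonelli _ _ _ _ _ nu (iid_pair mu)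
  (fun t : H * (H * H) => (`|p t.1|)%:E * h ((t.2.1 + t.1)%R, t.2.2)))//; last first.
  by move=> t; rewrite mule_ge0.
have mk' : measurable_fun [set: H * H] (fun w => \int[nu]_z
    ((`|p z|)%:E * h ((w.1 + z)%R, w.2))).
  apply: (measurable_fun_fubini_tonelli_G (m1 := nu)
    (fun t : H * (H * H) => (`|p t.1|)%:E * h ((t.2.1 + t.1)%R, t.2.2))) => //.
  by move=> t; rewrite mule_ge0.
have k0 w : 0 <= \int[nu]_z ((`|p z|)%:E * h ((w.1 + z)%R, w.2)).
  by apply: integral_ge0 => z _; rewrite mule_ge0.
rewrite !iid_pair_integral2//=; last 2 first.
- by apply: emeasurable_funM => //; apply: measurableT_comp mabs _.
- by move=> w; rewrite mule_ge0.
rewrite -ge0_integralZl//; last 3 first.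
- exact: (measurable_fun_fubini_tonelli_G (m1 := mu) _ mk' k0).
- move=> y _; apply: integral_ge0 => x _; apply: integral_ge0 => z _.
  by rewrite mule_ge0.
- by rewrite lee_fin ltW.
apply: eq_integral => y _; rewrite /fubini_G /=.
rewrite (mecke_mu (f := fun x => h (x, y)) pos_p)//.
exact: (measurableT_comp mh (pair2_measurable y)).
Qed.

Variable g : H -> \bar R.
Hypotheses (mg : measurable_fun [set: H] g) (g0 : forall x, 0 <= g x).

(** For [g] the indicator of A this is Pr(S + z in A), the weight shared by the linear and the
    quadratic identity. *)
Definition shifted_mean (z : H) := \int[iid_pair mu]_w g (w.1 + w.2 + z)%R.

Let mgS : measurable_fun [set: H * H] (fun w => g (w.1 + w.2)%R).
Proof. by apply: measurableT_comp => //; exact: measurable_hermD_pair. Qed.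

Let mgSz : measurable_fun [set: H * (H * H)]
  (fun t : H * (H * H) => g (t.2.1 + t.2.2 + t.1)%R).
Proof.
apply: measurableT_comp => //; apply: measurable_hermD => //.
by apply: measurable_hermD; apply: measurableT_comp.
Qed.

Lemma measurable_shifted_mean : measurable_fun [set: H] shifted_mean.
Proof.
exact: (measurable_fun_fubini_tonelli_F (m2 := (iid_pair mu))
  (fun t : H * (H * H) => g (t.2.1 + t.2.2 + t.1)%R)).
Qed.

Lemma shifted_mean_ge0 z : 0 <= shifted_mean z.
Proof. by apply: integral_ge0. Qed.

Lemma mecke_sum p : nonneg_functional nu p ->
  \int[iid_pair mu]_w ((`|p w.1|)%:E * g (w.1 + w.2)%R) =
  lam%:E * \int[nu]_z ((`|p z|)%:E * shifted_mean z).
Proof.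
move=> pos_p; rewrite (mecke_pair (h := fun w => g (w.1 + w.2)%R) pos_p)//.
congr (_ * _); apply: eq_integral => z _; congr (_ * _).
by apply: eq_integral => w _ /=; rewrite addrAC.
Qed.

(* q (x + z) = q x + q z after the shift; the q x part is the integral of the
   cross term up to exchanging the two coordinates. *)
Lemma mecke_square p q : nonneg_functional nu p -> nonneg_functional nu q ->
  \int[iid_pair mu]_w ((`|p w.1|)%:E * ((`|q w.1|)%:E * g (w.1 + w.2)%R)) =
  \int[iid_pair mu]_w ((`|p w.1|)%:E * ((`|q w.2|)%:E * g (w.1 + w.2)%R)) +
  lam%:E * \int[nu]_z ((`|p z|)%:E * ((`|q z|)%:E * shifted_mean z)).
Proof.
move=> pos_p pos_q; have [mp pD p0] := pos_p; have [mq qD q0] := pos_q.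
have mabsp := measurable_absE mp; have mabsq := measurable_absE mq.
have mq1 : measurable_fun [set: H * H] (fun w : H * H => (`|q w.1|)%:E * g (w.1 + w.2)%R).
  by apply: emeasurable_funM => //; apply: measurableT_comp mabsq _.
have mq2 : measurable_fun [set: H * H] (fun w : H * H => (`|q w.2|)%:E * g (w.1 + w.2)%R).
  by apply: emeasurable_funM => //; apply: measurableT_comp mabsq _.
have mqz1 : measurable_fun [set: H * (H * H)]
    (fun t : H * (H * H) => (`|q t.2.1|)%:E * g (t.2.1 + t.2.2 + t.1)%R).
  apply: emeasurable_funM => //.
  by apply: (measurableT_comp mabsq); apply: measurableT_comp.
rewrite (mecke_pair (h := fun w => (`|q w.1|)%:E * g (w.1 + w.2)%R) pos_p)//; last first.
  by move=> w; rewrite mule_ge0.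
rewrite (mecke_pair (h := fun w => (`|q w.2|)%:E * g (w.1 + w.2)%R) pos_p)//; last first.
  by move=> w; rewrite mule_ge0.
(* Both sides contain the integral of |p| times [a]. The identity is stated as a sum and not as a
   difference because this integral may be infinite at this generality. *)
pose a z := \int[iid_pair mu]_w ((`|q w.1|)%:E * g (w.1 + w.2 + z)%R).
have a0 z : 0 <= a z by apply: integral_ge0 => w _; rewrite mule_ge0.
have ma : measurable_fun [set: H] a.
  apply: (measurable_fun_fubini_tonelli_F (m2 := (iid_pair mu))
    (fun t : H * (H * H) => (`|q t.2.1|)%:E * g (t.2.1 + t.2.2 + t.1)%R)) => //.
  by move=> t; rewrite mule_ge0.
have mm := measurable_shifted_mean; have m0 := shifted_mean_ge0.
rewrite -ge0_muleDr; last 2 first.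
- apply: integral_ge0 => z _; rewrite mule_ge0//.
  by apply: integral_ge0 => w _; rewrite mule_ge0.
- by apply: integral_ge0 => z _; rewrite !mule_ge0.
congr (_ * _).
transitivity (\int[nu]_z ((`|p z|)%:E * (a z + (`|q z|)%:E * shifted_mean z))).
  have mN := measurable_negative_set mq.
  apply: (@ge0_integral_null_eq _ _ _ _ _ _ _ mN q0).
  - apply: emeasurable_funM => //.
    apply: (measurable_fun_fubini_tonelli_F (m2 := (iid_pair mu))
      (fun t : H * (H * H) => (`|q (t.2.1 + t.1)%R|)%:E * g (t.2.1 + t.1 + t.2.2)%R)).
      apply: emeasurable_funM.
        apply: measurableT_comp mabsq _; apply: measurable_hermD => //.
        exact: measurableT_comp.
      by under eq_fun do rewrite addrAC.
    by move=> t; rewrite mule_ge0.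
  - by apply: emeasurable_funM => //; apply: emeasurable_funD => //; exact: emeasurable_funM.
  - by move=> z; rewrite mule_ge0//; apply: integral_ge0 => w _; rewrite mule_ge0.
  - by move=> z; rewrite mule_ge0// adde_ge0// mule_ge0.
  move=> z /negP; rewrite -leNgt => qz0; congr (_ * _).
  have mgz : measurable_fun [set: H * H] (fun w => g (w.1 + w.2 + z)%R).
    exact: (measurableT_comp mgSz (pair1_measurable z)).
  have mqz : measurable_fun [set: H * H] (fun w : H * H => (`|q w.1|)%:E * g (w.1 + w.2 + z)%R).
    exact: (measurableT_comp mqz1 (pair1_measurable z)).
  rewrite /a /shifted_mean -ge0_integralZl// -ge0_integralD//; last 3 first.
  - by move=> w _; rewrite mule_ge0.
  - by move=> w _; rewrite mule_ge0.
  - exact: measurable_funeM.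
  apply: (@ge0_integral_null_eq _ _ _ _
      ([set x | (q x < 0)%R] `*` setT `|` setT `*` [set x | (q x < 0)%R])).
  - by apply: measurableU; exact: measurableX.
  - by apply: product_null_set => //; exact: null_mu.
  - apply: emeasurable_funM.
      apply: measurableT_comp mabsq _; apply: measurable_hermD => //.
    by under eq_fun do rewrite addrAC.
  - by apply: emeasurable_funD => //; exact: measurable_funeM.
  - by move=> w; rewrite mule_ge0.
  - by move=> w; rewrite adde_ge0// mule_ge0.
  move=> [x y] /= Nxy.
  have qx : (0 <= q x)%R by rewrite leNgt; apply/negP => qx; apply: Nxy; left.
  rewrite addrAC -ge0_muleDl//; congr (_ * _).
  by rewrite qD !ger0_norm// addr_ge0.
have swap z : \int[iid_pair mu]_w ((`|q w.2|)%:E * g (w.1 + z + w.2)%R) = a z.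
  rewrite /a -(@ge0_integral_swap _ _ _ mu (fun w : H * H =>
    (`|q w.1|)%:E * g (w.1 + w.2 + z)%R)).
  - apply: eq_integral => w _ /=; congr (_ * g _).
    by rewrite addrAC [(w.1 + w.2)%R]addrC.
  - exact: (measurableT_comp mqz1 (pair1_measurable z)).
  - by move=> w; rewrite mule_ge0.
under [X in X + _]eq_integral do rewrite /= swap.
rewrite -ge0_integralD//; last 4 first.
- by move=> z _; rewrite mule_ge0.
- exact: emeasurable_funM.
- by move=> z _; rewrite !mule_ge0.
- by apply: emeasurable_funM => //; exact: emeasurable_funM.
by apply: eq_integral => z _; rewrite ge0_muleDr// mule_ge0.
Qed.

End pair_mecke.

(** * From nonnegative to signed integrals *)

Section has_integral.
Context d (T : measurableType d) (R : realType) (m : {measure set T -> \bar R}).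

(** Integrability and value travel together, so that linear combinations of signed functions carry
    both. *)
Definition has_integral (F : T -> R) (v : R) : Prop :=
  m.-integrable [set: T] (EFin \o F) /\ (\int[m]_x (F x)%:E = v%:E)%E.

Lemma has_integral_comb a F G u v : has_integral F u -> has_integral G v ->
  has_integral (fun x => a * F x + G x) (a * u + v).
Proof.
move=> [iF Fu] [iG Gv].
have iaF : m.-integrable [set: T] (EFin \o (fun x => a * F x)).
  exact: (integrableZl measurableT a iF).
split; first exact: (integrableD measurableT iaF iG).
rewrite (@integralD _ _ _ _ _ measurableT (EFin \o (fun x => a * F x)) (EFin \o G))//.
by rewrite (integralZl measurableT iF) Fu Gv.
Qed.

(** Off a null set [F] coincides with the nonnegative [G], so the finite value [v] is also the
    integral of |F|: a Tonelli computation yields integrability at once. *)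
Lemma has_integral_null (N : set T) (F : T -> R) (G : T -> \bar R) v :
  measurable N -> m N = 0 ->
  measurable_fun [set: T] F -> measurable_fun [set: T] G ->
  (forall x, 0 <= G x)%E -> (forall x, ~ N x -> (F x)%:E = G x) ->
  (\int[m]_x G x = v%:E)%E -> has_integral F v.
Proof.
move=> mN N0 mF mG G0 FG Gv.
have mF' : measurable_fun [set: T] (EFin \o F) by apply/measurable_EFinP.
split; last first.
  rewrite -Gv; apply: ae_eq_integral => //.
  exists N; split => // x /= h; apply: contrapT => Nx; apply: h => _.
  exact: FG.
apply/integrableP; split => //.
rewrite (_ : (\int[m]_x _)%E = (\int[m]_x G x)%E); first by rewrite Gv ltry.
apply: (ge0_integral_null_eq mN N0) => //; first exact: measurableT_comp.
by move=> x Nx; rewrite /= -abse_EFin FG// gee0_abs.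
Qed.

Lemma has_integral0 : has_integral (fun=> 0) 0.
Proof.
by apply: (@has_integral_null set0 _ (cst 0%E)) => //; rewrite integral0.
Qed.

End has_integral.

(** * Linear and quadratic functionals of the sum and the difference *)

Section poisson_core.
Variables (R : realType) (K : starAlgType R) (n : nat).
Local Notation H := (herm K n).
Variables (mu nu : probability H R) (lam : R).

Hypothesis lam_gt0 : 0 < lam.
Hypothesis mecke_mu : forall (p : H -> R) (f : H -> \bar R),
  nonneg_functional nu p -> measurable_fun [set: H] f -> (forall x, 0 <= f x)%E ->
  (\int[mu]_x ((`|p x|)%:E * f x) =
  lam%:E * \int[mu]_x \int[nu]_z ((`|p z|)%:E * f (x + z)%R))%E.
Hypothesis null_mu : forall p : H -> R, nonneg_functional nu p ->
  mu [set z | p z < 0] = 0.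

Definition idempotents := [set A : H | A *m A = A].

Hypothesis nu_idem : nu (~` idempotents) = 0.

Lemma bounded_integral_fin (f : H -> \bar R) (M : R) :
  measurable_fun [set: H] f -> (forall x, 0 <= f x)%E ->
  (forall z, idempotents z -> f z <= M%:E)%E -> (\int[nu]_z f z \is a fin_num)%E.
Proof.
move=> mf f0 fM; rewrite ge0_fin_numE; last exact: integral_ge0.
have M0 : (0 <= `|M|%:E)%E by rewrite lee_fin.
apply: (@le_lt_trans _ _ (\int[nu]_(z in [set: H]) (`|M|)%:E)%E).
  apply: ae_ge0_le_integral => //.
  exists (~` idempotents); split => //.
    by apply: measurableC; exact: measurable_idempotent.
  move=> x /=; apply: contra_not => ix _; apply: le_trans (fM _ ix) _.
  by rewrite lee_fin ler_norm.
rewrite integral_cst// [X in (_ * X)%E]probability_setT mule1; exact: ltry.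
Qed.

(** The sign makes Mecke's identity applicable; the bound makes the jump integrals finite, and
    through that identity the moments of [mu] as well. *)
Definition bounded_nonneg_functional (p : H -> R) : Prop :=
  [/\ measurable_fun [set: H] p, {morph p : x y / x + y} &
      exists M, forall z, idempotents z -> 0 <= p z <= M].

Lemma bounded_nonneg p : bounded_nonneg_functional p -> nonneg_functional nu p.
Proof.
move=> [mp pD [M pM]]; split => //.
apply/eqP; rewrite eq_le measure_ge0 andbT -nu_idem.
apply: le_measure; rewrite ?inE.
- exact: measurable_negative_set.
- by apply: measurableC; exact: measurable_idempotent.
by move=> z /= pz iz; move: (pM z iz); rewrite leNgt pz.
Qed.

(** Mecke's identity with [f] constantly 1 turns the mean into [lam] times the integral over jumps
    of a function bounded on projections. *)
Lemma mean_fin p : bounded_nonneg_functional p ->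
  (\int[mu]_x (`|p x|)%:E \is a fin_num)%E.
Proof.
move=> bp; have [mp pD [M pM]] := bp.
have := mecke_mu (f := cst 1%E) (bounded_nonneg bp) (measurable_cst _) (fun=> lee01).
under eq_integral do rewrite mule1.
move=> ->.
under eq_integral do under eq_integral do rewrite mule1.
rewrite integral_cst// [X in (_ * (_ * X))%E]probability_setT mule1 fin_numM//.
apply: (@bounded_integral_fin _ M) => //; first exact: measurable_absE.
by move=> z /pM /andP[p0 pM']; rewrite lee_fin ger0_norm.
Qed.

Lemma cross_fin p q : bounded_nonneg_functional p -> bounded_nonneg_functional q ->
  (\int[iid_pair mu]_w ((`|p w.1|)%:E * (`|q w.2|)%:E) \is a fin_num)%E.
Proof.
move=> bp bq; have [mp _ _] := bp; have [mq _ _] := bq.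
have mabsp := measurable_absE mp; have mabsq := measurable_absE mq.
rewrite iid_pair_integral1//; last first.
  by apply: emeasurable_funM;
    [apply: measurableT_comp mabsp _|apply: measurableT_comp mabsq _].
under eq_integral.
  move=> x _; rewrite /= ge0_integralZl//; over.
rewrite ge0_integralZr//; last exact: integral_ge0.
by rewrite fin_numM//; exact: mean_fin.
Qed.

Section fixed_set.
Variable A : set H.
Hypothesis mA : measurable A.

Let g (x : H) : \bar R := (\1_A x : R)%:E.

Let mg : measurable_fun [set: H] g.
Proof. by apply/measurable_EFinP; exact: measurable_indic. Qed.

Let g0 x : (0 <= g x)%E. Proof. by rewrite lee_fin. Qed.

Let g1 x : (g x <= 1)%E.
Proof. by rewrite lee_fin indicE; case: (_ \in _). Qed.

Definition mean_in (z : H) : R := fine (shifted_mean mu g z).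

Let mean_le1 z : (shifted_mean mu g z <= 1)%E.
Proof.
apply: (@le_trans _ _ (\int[iid_pair mu]_(w in [set: H * H]) 1)%E).
  apply: ge0_le_integral => //.
  apply: measurableT_comp mg _; apply: measurable_hermD => //.
  exact: measurable_hermD_pair.
by rewrite integral_cst// [X in (_ * X)%E]probability_setT mule1.
Qed.

Let mean_inE z : (mean_in z)%:E = shifted_mean mu g z.
Proof.
rewrite /mean_in fineK// ge0_fin_numE; last exact: shifted_mean_ge0.
by apply: le_lt_trans (mean_le1 z) _; rewrite ltry.
Qed.

Let mean_in01 z : 0 <= mean_in z <= 1.
Proof. by rewrite -!lee_fin mean_inE mean_le1 shifted_mean_ge0. Qed.

Let measurable_mean : measurable_fun [set: H] mean_in.
Proof.
apply/measurable_EFinP.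
rewrite (_ : EFin \o mean_in = shifted_mean mu g); first exact: measurable_shifted_mean.
by apply/funext => z; rewrite /= mean_inE.
Qed.

Definition sum_in (w : H * H) : R := \1_A (w.1 + w.2).

Let measurable_sum_in : measurable_fun [set: H * H] sum_in.
Proof.
rewrite (_ : sum_in = (\1_A : H -> R) \o (fun w => w.1 + w.2)) //.
by apply: measurableT_comp; [exact: measurable_indic|exact: measurable_hermD_pair].
Qed.

(** The two coordinates contribute equally by symmetry, hence the factor 2. The witness is the jump
    integral [J], finite because [p] is bounded on projections and [mean_in] is a probability. *)
Lemma has_integral_linear p : bounded_nonneg_functional p ->
  exists v, has_integral (iid_pair mu) (fun w => p (w.1 + w.2) * sum_in w) (2 * lam * v)
    /\ has_integral nu (fun z => p z * mean_in z) v.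
Proof.
move=> bp; have [mp pD [M pM]] := bp; have pos_p := bounded_nonneg bp.
have [_ _ p0] := pos_p.
have mabsp := measurable_absE mp.
have mN := measurable_negative_set mp.
have E := mecke_sum lam_gt0 mecke_mu mg g0 pos_p.
set J := (\int[nu]_z _)%E in E.
have Jfin : (J \is a fin_num)%E.
  apply: (@bounded_integral_fin _ M).
  - by apply: emeasurable_funM => //; exact: measurable_shifted_mean.
  - by move=> z; rewrite mule_ge0//; exact: shifted_mean_ge0.
  - move=> z /pM /andP[pz pzM]; rewrite -mean_inE -EFinM lee_fin.
    have /andP[m0 m1] := mean_in01 z.
    by rewrite ger0_norm// (le_trans _ pzM)// ler_piMr.
pose N := [set x | p x < 0] `*` [set: H] `|` [set: H] `*` [set x | p x < 0].
have mNN : measurable N by apply: measurableU; exact: measurableX.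
have NN0 : iid_pair mu N = 0 by apply: product_null_set => //; exact: null_mu.
have mF1 : measurable_fun [set: H * H] (fun w : H * H => p w.1 * sum_in w).
  by apply: measurable_funM => //; exact: measurableT_comp.
have mF2 : measurable_fun [set: H * H] (fun w : H * H => p w.2 * sum_in w).
  by apply: measurable_funM => //; exact: measurableT_comp.
have mG : measurable_fun [set: H * H] (fun w : H * H => (`|p w.1|)%:E * g (w.1 + w.2)%R)%E.
  apply: emeasurable_funM; first exact: measurableT_comp mabsp _.
  by apply: measurableT_comp mg _; exact: measurable_hermD_pair.
have mG2 : measurable_fun [set: H * H] (fun w : H * H => (`|p w.2|)%:E * g (w.2 + w.1)%R)%E.
  apply: emeasurable_funM; first exact: measurableT_comp mabsp _.
  by apply: measurableT_comp mg _; apply: measurable_hermD.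
have h1 : has_integral (iid_pair mu) (fun w => p w.1 * sum_in w) (lam * fine J).
  apply: (has_integral_null mNN NN0 mF1 mG) => [w|[x y] /= Nw|].
  - by rewrite mule_ge0.
  - have px : 0 <= p x by rewrite leNgt; apply/negP => px; apply: Nw; left.
    by rewrite ger0_norm// EFinM.
  - by rewrite E EFinM fineK.
have h2 : has_integral (iid_pair mu) (fun w => p w.2 * sum_in w) (lam * fine J).
  apply: (has_integral_null mNN NN0 mF2 mG2) => [w|[x y] /= Nw|].
  - by rewrite mule_ge0.
  - have px : 0 <= p y by rewrite leNgt; apply/negP => px; apply: Nw; right.
    by rewrite ger0_norm// EFinM addrC.
  - rewrite (ge0_integral_swap mu mG) => [|w]; last by rewrite mule_ge0.
    by rewrite E EFinM fineK.
exists (fine J); split.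
  have := has_integral_comb 1 h1 h2; congr has_integral; last by ring.
  by apply/funext => w /=; rewrite pD; ring.
apply: (@has_integral_null _ _ _ _ (~` idempotents) _
    (fun z => (`|p z|)%:E * shifted_mean mu g z)%E) => //.
- by apply: measurableC; exact: measurable_idempotent.
- exact: measurable_funM.
- by apply: emeasurable_funM => //; exact: measurable_shifted_mean.
- by move=> z; rewrite mule_ge0//; exact: shifted_mean_ge0.
- by move=> z /contrapT /pM /andP[pz _]; rewrite ger0_norm// -mean_inE.
- by rewrite fineK.
Qed.

(** Expanding p(D) q(D) gives two diagonal and two cross terms, equal in pairs by exchange of the
    coordinates. Each diagonal term exceeds the cross term [y] by [lam] times [J] ([mecke_square]),
    so the total is 2 (y + lam J) - 2 y. *)
Lemma has_integral_quadratic p q :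
  bounded_nonneg_functional p -> bounded_nonneg_functional q ->
  exists v, has_integral (iid_pair mu)
      (fun w => p (w.1 - w.2) * q (w.1 - w.2) * sum_in w) (2 * lam * v)
    /\ has_integral nu (fun z => p z * q z * mean_in z) v.
Proof.
move=> bp bq; have [mp pD [M pM]] := bp; have [mq qD [M' qM]] := bq.
have pos_p := bounded_nonneg bp; have pos_q := bounded_nonneg bq.
have mabsp := measurable_absE mp; have mabsq := measurable_absE mq.
have E := mecke_square lam_gt0 mecke_mu null_mu mg g0 pos_p pos_q.
have mS : measurable_fun [set: H * H] (fun w => g (w.1 + w.2)).
  by apply: measurableT_comp mg _; exact: measurable_hermD_pair.
have mS' : measurable_fun [set: H * H] (fun w => g (w.2 + w.1)).
  by apply: measurableT_comp mg _; apply: measurable_hermD.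
have ms i : measurable_fun [set: H * H] (fun w : H * H => if i then w.1 else w.2).
  by case: i; [exact: measurable_fst|exact: measurable_snd].
(* The booleans tell which variable [p] and [q] read, [true] being the first. *)
pose G i j (w : H * H) := ((`|p (if i then w.1 else w.2)|)%:E *
  ((`|q (if j then w.1 else w.2)|)%:E * g (w.1 + w.2)%R))%E.
have mG i j : measurable_fun [set: H * H] (G i j).
  apply: emeasurable_funM; first exact: measurableT_comp mabsp (ms i).
  by apply: emeasurable_funM => //; exact: measurableT_comp mabsq (ms j).
have G0 i j w : (0 <= G i j w)%E by rewrite !mule_ge0.
set J := (\int[nu]_z _)%E in E.
have Jfin : (J \is a fin_num)%E.
  apply: (@bounded_integral_fin _ (M * M')).
  - by do 2! apply: emeasurable_funM => //; exact: measurable_shifted_mean.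
  - by move=> z; rewrite !mule_ge0//; exact: shifted_mean_ge0.
  - move=> z iz; have /andP[pz pzM] := pM z iz; have /andP[qz qzM] := qM z iz.
    rewrite -mean_inE -!EFinM lee_fin !ger0_norm//.
    have /andP[m0 m1] := mean_in01 z.
    by rewrite ler_pM ?mulr_ge0// (le_trans _ qzM)// ler_piMr.
(* The cross term is going to be subtracted, so it must be finite; the indicator is at most 1, which
   reduces this to [cross_fin]. *)
have Yfin : (\int[iid_pair mu]_w G true false w \is a fin_num)%E.
  rewrite ge0_fin_numE; last exact: integral_ge0.
  have := cross_fin bp bq; rewrite ge0_fin_numE; last first.
    by apply: integral_ge0 => w _; rewrite mule_ge0.
  apply: le_lt_trans; apply: ge0_le_integral => //.
  - by apply: emeasurable_funM;
    [apply: measurableT_comp mabsp _|apply: measurableT_comp mabsq _].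
  - move=> w _; rewrite /G lee_wpmul2l// -[leRHS]mule1 lee_wpmul2l//.
set y := fine (\int[iid_pair mu]_w G true false w).
have YE : (\int[iid_pair mu]_w G true false w = y%:E)%E by rewrite fineK.
have XE : (\int[iid_pair mu]_w G true true w = (y + lam * fine J)%:E)%E.
  by rewrite EFinD EFinM -YE (fineK Jfin); exact: E.
have swapE i j : (\int[iid_pair mu]_w G i j w = \int[iid_pair mu]_w G (~~ i) (~~ j) w)%E.
  rewrite -(ge0_integral_swap mu (mG i j))//; apply: eq_integral => w _.
  by rewrite /G /= addrC; case: i; case: j.
pose N0 := [set x | p x < 0] `|` [set x | q x < 0].
have mN0 : measurable N0 by apply: measurableU; exact: measurable_negative_set.
have N00 : mu N0 = 0.
  apply/eqP; rewrite eq_le measure_ge0 andbT.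
  apply: le_trans (measureU2 _ _ _) _;
    [exact: measurable_negative_set|exact: measurable_negative_set|].
  by rewrite [X in (X + _)%E](null_mu pos_p) [X in (_ + X)%E](null_mu pos_q) adde0.
pose N := N0 `*` [set: H] `|` [set: H] `*` N0.
have mN : measurable N by apply: measurableU; exact: measurableX.
have NN0 : iid_pair mu N = 0 by exact: product_null_set.
pose F i j (w : H * H) := p (if i then w.1 else w.2) * q (if j then w.1 else w.2) * sum_in w.
have hF i j v : (\int[iid_pair mu]_w G i j w = v%:E)%E ->
    has_integral (iid_pair mu) (F i j) v.
  apply: (has_integral_null mN NN0 _ (mG i j) (G0 i j)).
    apply: measurable_funM => //; apply: measurable_funM.
      exact: (measurableT_comp mp (ms i)).
    exact: (measurableT_comp mq (ms j)).
  move=> [a b] /= Nw; rewrite /F /G /= /sum_in /= -!EFinM mulrA.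
  have pos k : 0 <= p (if k then a else b) /\ 0 <= q (if k then a else b).
    by split; rewrite leNgt; apply/negP => lt0; apply: Nw; case: k lt0 => lt0;
       [left|right|left|right]; split => //; [left|left|right|right].
  by rewrite !ger0_norm//; have [] := pos i; have [] := pos j.
exists (fine J); split.
  have h11 := hF true true _ XE.
  have h12 := hF true false _ YE.
  have h22 := hF false false _ (etrans (swapE false false) XE).
  have h21 := hF false true _ (etrans (swapE false true) YE).
  have := has_integral_comb (-1) h12 (has_integral_comb (-1) h21 (has_integral_comb 1 h11 h22)).
  congr has_integral; last by ring.
  have pB x z : p (x - z) = p x - p z.
    by apply: (@addIr _ (p z)); rewrite -pD !subrK.
  have qB x z : q (x - z) = q x - q z.
    by apply: (@addIr _ (q z)); rewrite -qD !subrK.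
  by apply/funext => w; rewrite /F pB qB; ring.
apply: (@has_integral_null _ _ _ _ (~` idempotents) _
    (fun z => (`|p z|)%:E * ((`|q z|)%:E * shifted_mean mu g z))%E) => //.
- by apply: measurableC; exact: measurable_idempotent.
- by do 2! apply: measurable_funM => //.
- by do 2! apply: emeasurable_funM => //; exact: measurable_shifted_mean.
- by move=> z; rewrite !mule_ge0//; exact: shifted_mean_ge0.
- move=> z /contrapT iz; have /andP[pz _] := pM z iz; have /andP[qz _] := qM z iz.
  by rewrite !ger0_norm// -mean_inE -!EFinM mulrA.
- by rewrite fineK.
Qed.

End fixed_set.

End poisson_core.

Arguments idempotents {R} K n _.

(** * Functionals of the pair matched with functionals of a jump *)

Section matched_functionals.
Variables (R : realType) (K : starAlgType R) (n : nat).
Local Notation H := (herm K n).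
Variables (mu nu : probability H R) (lam : R).

Hypothesis lam_gt0 : 0 < lam.
Hypothesis mecke_mu : forall (p : H -> R) (f : H -> \bar R),
  nonneg_functional nu p -> measurable_fun [set: H] f -> (forall x, 0 <= f x)%E ->
  (\int[mu]_x ((`|p x|)%:E * f x) =
  lam%:E * \int[mu]_x \int[nu]_z ((`|p z|)%:E * f (x + z)%R))%E.
Hypothesis null_mu : forall p : H -> R, nonneg_functional nu p ->
  mu [set z | p z < 0] = 0.
Hypothesis nu_idem : nu (~` idempotents K n) = 0.

(* F is a function of two independent variables with law mu, f one of a jump;
   mean_in mu A z is the probability that their sum shifted by z lies in A. *)
Definition matched (F : H * H -> R) (f : H -> R) : Prop :=
  forall A, measurable A -> exists v,
    has_integral (iid_pair mu) (fun w => F w * sum_in A w) (2 * lam * v) /\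
    has_integral nu (fun z => f z * mean_in mu A z) v.

Lemma matched_comb a F f G g : matched F f -> matched G g ->
  matched (fun w => a * F w + G w) (fun z => a * f z + g z).
Proof.
move=> hF hG A mA; have [u [F1 f1]] := hF A mA; have [v [G1 g1]] := hG A mA.
exists (a * u + v); split.
  have := has_integral_comb a F1 G1; congr has_integral; last by ring.
  by apply/funext => w; ring.
have := has_integral_comb a f1 g1; congr has_integral.
by apply/funext => w; ring.
Qed.

Lemma matched0 : matched (fun=> 0) (fun=> 0).
Proof.
move=> A mA; exists 0; rewrite mulr0; split.
  have := has_integral0 (iid_pair mu); congr has_integral.
  by apply/funext => w; rewrite mul0r.
have := has_integral0 nu; congr has_integral.
by apply/funext => w; rewrite mul0r.
Qed.

Lemma matched_eq F f G g : F =1 G -> f =1 g -> matched F f -> matched G g.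
Proof. by move=> /funext -> /funext ->. Qed.

Lemma matched_sum I (r : seq I) (F : I -> H * H -> R) (f : I -> H -> R) :
  (forall i, matched (F i) (f i)) ->
  matched (fun w => \sum_(i <- r) F i w) (fun z => \sum_(i <- r) f i z).
Proof.
move=> hF; elim: r => [|i r IHr].
  by apply: matched_eq matched0 => x; rewrite big_nil.
by apply: matched_eq (matched_comb 1 (hF i) IHr) => x; rewrite big_cons mul1r.
Qed.

Lemma matchedZ a F f : matched F f ->
  matched (fun w => a * F w) (fun z => a * f z).
Proof.
by move=> hF; apply: matched_eq (matched_comb a hF matched0) => x; rewrite addr0.
Qed.

(** Coordinates have no sign of their own; differences reduce them, and their products after
    expansion, to the nonnegative case. *)
Definition tame (c : H -> R) : Prop :=
  exists p q, [/\ bounded_nonneg_functional p, bounded_nonneg_functional q &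
    forall x, c x = p x - q x].

(* c = (c + M t) - M t *)
Lemma dominated_tame (c t : H -> R) (M : R) : 0 <= M ->
  measurable_fun [set: H] c -> {morph c : x y / x + y} ->
  bounded_nonneg_functional t ->
  (forall z, idempotents K n z -> `|c z| <= M * t z) -> tame c.
Proof.
move=> M0 mc cD bt ct; have [mt tD [B tB]] := bt.
exists (fun x => c x + M * t x), (fun x => M * t x); split; last first.
- by move=> x; rewrite addrK.
- split.
  + by apply: measurable_funM => //.
  + by move=> x y; rewrite tD mulrDr.
  exists (M * B) => z iz; have /andP[t0 tle] := tB z iz.
  by rewrite mulr_ge0//= ler_wpM2l.
- split.
  + by apply: measurable_funD => //; exact: measurable_funM.
  + by move=> x y; rewrite cD tD mulrDr addrACA.
  exists (M * B + M * B) => z iz; have /andP[t0 tle] := tB z iz.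
  have := ct z iz; rewrite ler_norml => /andP[c1 c2].
  have : M * t z <= M * B by rewrite ler_wpM2l.
  lra.
Qed.

Lemma matched_tame c : tame c -> matched (fun w => c (w.1 + w.2)) c.
Proof.
move=> [p [q [bp bq cE]]].
have hp : matched (fun w => p (w.1 + w.2)) p.
  by move=> A mA; exact: (has_integral_linear lam_gt0 mecke_mu null_mu nu_idem mA bp).
have hq : matched (fun w => q (w.1 + w.2)) q.
  by move=> A mA; exact: (has_integral_linear lam_gt0 mecke_mu null_mu nu_idem mA bq).
by apply: matched_eq (matched_comb (-1) hq hp) => x; rewrite cE; ring.
Qed.

Lemma matched_tameM c1 c2 : tame c1 -> tame c2 ->
  matched (fun w => c1 (w.1 - w.2) * c2 (w.1 - w.2)) (fun z => c1 z * c2 z).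
Proof.
move=> [p [q [bp bq cE]]] [p' [q' [bp' bq' cE']]].
have h r s : bounded_nonneg_functional r -> bounded_nonneg_functional s ->
    matched (fun w => r (w.1 - w.2) * s (w.1 - w.2)) (fun z => r z * s z).
  move=> br bs A mA.
  exact: (has_integral_quadratic lam_gt0 mecke_mu null_mu nu_idem mA br bs).
apply: matched_eq (matched_comb (-1) (h _ _ bp bq')
  (matched_comb (-1) (h _ _ bq bp') (matched_comb 1 (h _ _ bp bp') (h _ _ bq bq')))) => x;
  by rewrite cE cE'; ring.
Qed.

(** The jump integral determines the expectation over the pair, and [nu] charges only projections,
    so agreement on projections is enough. *)
Lemma matched_idem_eq F f G g : matched F f -> matched G g ->
  (forall z, idempotents K n z -> f z = g z) ->
  forall A, measurable A -> exists v,
    has_integral (iid_pair mu) (fun w => F w * sum_in A w) v /\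
    has_integral (iid_pair mu) (fun w => G w * sum_in A w) v.
Proof.
move=> hF hG fg A mA; have [u [F1 [f1 fu]]] := hF A mA; have [v [G1 [g1 gv]]] := hG A mA.
suff uv : u = v by exists (2 * lam * v); rewrite -{1}uv.
suff : (u%:E = v%:E)%E by move=> [].
rewrite -fu -gv; apply: ae_eq_integral => //.
- exact: measurable_int f1.
- exact: measurable_int g1.
exists (~` idempotents K n); split => //.
  by apply: measurableC; exact: measurable_idempotent.
by move=> z /=; apply: contra_not => iz _; rewrite fg.
Qed.

(** For nonnegative p, [mecke_square] with g = 1 and q = p expresses the second moment as a product
    of two finite first moments plus [lam] times the jump integral of p^2. *)
Lemma tame_second_moment c : tame c -> measurable_fun [set: H] c ->
  (\int[mu]_x ((c x) ^+ 2)%:E < +oo)%E.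
Proof.
have sq p : bounded_nonneg_functional p -> (\int[mu]_x ((p x) ^+ 2)%:E < +oo)%E.
  move=> bp; have [mp pD [M pM]] := bp; have pos_p := bounded_nonneg nu_idem bp.
  have mabsp := measurable_absE mp.
  have m1 : measurable_fun [set: H] (cst 1%E : H -> \bar R) by [].
  have sqE x : (\int[mu]_y (`|p (x, y).1|%:E * `|p (x, y).1|%:E) = (p x ^+ 2)%:E)%E.
    under eq_integral do rewrite /=.
    rewrite (integral_cst _ _ (`|p x|%:E * `|p x|%:E)%E)// [X in (_ * X)%E]probability_setT.
    by rewrite mule1 -EFinM -normrM ger0_norm ?sqr_ge0.
  have := mecke_square lam_gt0 mecke_mu null_mu m1 (fun=> lee01) pos_p pos_p.
  under eq_integral do rewrite mule1.
  under [X in _ = (X + _)%E]eq_integral do rewrite mule1.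
  rewrite iid_pair_integral1//; last first.
    by apply: emeasurable_funM; apply: measurableT_comp mabsp _.
  rewrite [X in X = _ -> _](_ : _ = \int[mu]_x ((p x) ^+ 2)%:E)%E; last first.
    by apply: eq_integral => x _; exact: sqE.
  move=> ->; apply: lte_add_pinfty.
    have := cross_fin mecke_mu nu_idem bp bp.
    by rewrite ge0_fin_numE// integral_ge0// => w _; rewrite mule_ge0.
  apply: lte_mul_pinfty => //; first by rewrite lee_fin ltW.
  have one z : shifted_mean mu (cst 1%E) z = 1%E.
    by rewrite /shifted_mean /= integral_cst// [X in (_ * X)%E]probability_setT mule1.
  under eq_integral do rewrite one mule1.
  have : (\int[nu]_z (`|p z|%:E * `|p z|%:E) \is a fin_num)%E.
    apply: (bounded_integral_fin nu_idem (M := M * M)).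
    - exact: emeasurable_funM.
    - by move=> z; rewrite mule_ge0.
    - by move=> z /pM /andP[p0 p1]; rewrite -EFinM lee_fin ger0_norm// ler_pM.
  by rewrite ge0_fin_numE// integral_ge0// => w _; rewrite mule_ge0.
move=> [p [q [bp bq cE]]] mc; have [mp _ _] := bp; have [mq _ _] := bq.
have mp2 : measurable_fun [set: H] (fun x => (p x ^+ 2)%:E).
  by apply/measurable_EFinP; exact: measurable_funX.
have mq2 : measurable_fun [set: H] (fun x => (q x ^+ 2)%:E).
  by apply/measurable_EFinP; exact: measurable_funX.
(* (p - q)^2 <= 2 (p^2 + q^2), because (p + q)^2 >= 0. *)
apply: (@le_lt_trans _ _ (\int[mu]_x (2%:E * ((p x ^+ 2)%:E + (q x ^+ 2)%:E)))%E).
  apply: ge0_le_integral => //.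
  - by move=> x _; rewrite lee_fin sqr_ge0.
  - by apply/measurable_EFinP; exact: measurable_funX.
  - by apply: measurable_funeM; exact: emeasurable_funD.
  - move=> x _; rewrite -EFinD -EFinM lee_fin cE.
    by have := sqr_ge0 (p x + q x); rewrite !expr2 => h; nra.
rewrite ge0_integralZl//; last 2 first.
- exact: emeasurable_funD.
- by move=> x _; rewrite adde_ge0// lee_fin sqr_ge0.
apply: lte_mul_pinfty => //.
rewrite ge0_integralD//; last 2 first.
- by move=> x _; rewrite lee_fin sqr_ge0.
- by move=> x _; rewrite lee_fin sqr_ge0.
by apply: lte_add_pinfty; exact: sq.
Qed.

Hypothesis coord_tame : forall i j k, tame (fun A : H => mx_coord i j k A).

Lemma matched_square i j k :
  matched (fun w => mx_coord i j k ((w.1 - w.2 : 'M[K]_n) ^+ 2))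
          (fun z : H => mx_coord i j k (z *m z)).
Proof.
pose L := real_linear_coord k.
have E (z : H) : mx_coord i j k (z *m z) =
    \sum_l \sum_(a < \dim {:K}) \sum_(b < \dim {:K})
      coord (vbasis {:K}) k ((vbasis {:K})`_a * (vbasis {:K})`_b) *
        (mx_coord i l a z * mx_coord l j b z).
  rewrite /mx_coord mxE linear_sum; apply: eq_bigr => l _.
  exact: (real_linear_mul _ _ L).
have h : matched (fun w => \sum_l \sum_(a < \dim {:K}) \sum_(b < \dim {:K})
      coord (vbasis {:K}) k ((vbasis {:K})`_a * (vbasis {:K})`_b) *
        (mx_coord i l a (w.1 - w.2) * mx_coord l j b (w.1 - w.2)))
    (fun z : H => \sum_l \sum_(a < \dim {:K}) \sum_(b < \dim {:K})
      coord (vbasis {:K}) k ((vbasis {:K})`_a * (vbasis {:K})`_b) *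
        (mx_coord i l a z * mx_coord l j b z)).
  apply: matched_sum => l; apply: matched_sum => a; apply: matched_sum => b.
  apply: matchedZ.
  exact: (matched_tameM (coord_tame i l a) (coord_tame l j b)).
apply: matched_eq h => [w|z]; last by rewrite E.
exact: (esym (E (w.1 - w.2))).
Qed.

Lemma coord_conditional_identity i j k A : measurable A -> exists v,
  has_integral (iid_pair mu)
    (fun w => mx_coord i j k ((w.1 - w.2 : 'M[K]_n) ^+ 2) * sum_in A w) v /\
  has_integral (iid_pair mu)
    (fun w => mx_coord i j k (w.1 + w.2 : 'M[K]_n) * sum_in A w) v.
Proof.
apply: matched_idem_eq (matched_square i j k) (matched_tame (coord_tame i j k)) _ A.
(* Idempotency of the jumps turns the quadratic functional of [z] into the linear one. *)
by move=> z iz; rewrite iz.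
Qed.

Lemma finite_second_moments_tame : finite_second_moments mu.
Proof.
move=> i j k; apply: tame_second_moment => //; exact: measurable_mx_coord.
Qed.

End matched_functionals.

(** * Domination of coordinates by the trace on projections *)

Section trace_form.
Variables (R : realType) (K : starAlgType R).

(* Makes the trace dominate every coordinate on projections, since z = z z^*. *)
Definition trace_form (re : K -> R) : Prop :=
  [/\ real_linear re,
      forall x, (re x) ^+ 2 <= re (x * star x) &
      forall phi, real_linear phi -> exists2 M, 0 <= M &
        forall x y, `|phi (x * star y)| <= M * (re (x * star x) + re (y * star y))].

Variables (n : nat) (re : K -> R).
Hypothesis re_form : trace_form re.
Local Notation H := (herm K n).

Let re_lin : real_linear re. Proof. by case: re_form. Qed.

Let re_sq x : (re x) ^+ 2 <= re (x * star x).
Proof. by case: re_form => _ + _; exact. Qed.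

Let re_ge0 x : 0 <= re (x * star x).
Proof. exact: le_trans (sqr_ge0 _) (re_sq x). Qed.

Lemma herm_entry_star (A : H) i j : star (A i j) = A j i.
Proof.
have /eqP hA := hermP A.
by rewrite -[in RHS]hA !mxE.
Qed.

Lemma idempotent_entry (A : H) i j : idempotents K n A ->
  A i j = \sum_l A i l * star (A j l).
Proof.
move=> AA; rewrite -[in LHS]AA mxE; apply: eq_bigr => l _.
by rewrite herm_entry_star.
Qed.

(** Let t be the real part of the diagonal entry. Since A = A A^*, t is a sum of nonnegative terms,
    the one with l = i being at least t^2; hence t^2 <= t. *)
Lemma idempotent_diag (A : H) i : idempotents K n A -> 0 <= re (A i i) <= 1.
Proof.
move=> AA; have E : re (A i i) = \sum_l re (A i l * star (A i l)).
  by rewrite {1}(idempotent_entry i i AA) real_linear_sum.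
have r0 : 0 <= re (A i i) by rewrite E sumr_ge0.
have : (re (A i i)) ^+ 2 <= re (A i i).
  rewrite {2}E (bigD1 i)//= (le_trans (re_sq _))// lerDl.
  exact: sumr_ge0.
by rewrite r0 expr2; nra.
Qed.

Definition re_trace (A : H) : R := \sum_i re (A i i).

Lemma re_trace_bounded_nonneg : bounded_nonneg_functional re_trace.
Proof.
split.
- apply: measurable_sum => i.
  apply: (kmeasurable_linear (f := fun A : H => A i i)) => //.
  exact: (@kmeasurable_herm _ _ _ _ _ (fun A : H => A)).
- move=> A B; rewrite /re_trace -big_split; apply: eq_bigr => i _.
  by rewrite mxE real_linearD.
exists n%:R => A AA; rewrite sumr_ge0/= => [|i _]; last first.
  by have /andP[] := idempotent_diag i AA.
rewrite -[leRHS]mulr1 -[n in leRHS]card_ord mulr_natl -sumr_const.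
by apply: ler_sum => i _; have /andP[] := idempotent_diag i AA.
Qed.

Lemma coord_tame i j k : tame (fun A : H => mx_coord i j k A).
Proof.
have [_ _ /(_ _ (real_linear_coord k))[M M0 phiM]] := re_form.
(* [M] bounds the coordinate by two diagonal real parts, each at most the trace; hence the factor
   2. *)
apply: (@dominated_tame _ _ _ _ re_trace (M * 2)).
- by rewrite mulr_ge0.
- exact: measurable_mx_coord.
- by move=> A B; rewrite mx_coordD.
- exact: re_trace_bounded_nonneg.
move=> A AA; rewrite /mx_coord (idempotent_entry i j AA) linear_sum.
apply: le_trans (ler_norm_sum _ _ _) _.
apply: (@le_trans _ _ (M * (re (A i i) + re (A j j)))).
  rewrite (idempotent_entry i i AA) (idempotent_entry j j AA).
  rewrite !(real_linear_sum _ _ _ re_lin) -big_split mulr_sumr.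
  by apply: ler_sum => l _; exact: phiM.
rewrite -mulrA ler_wpM2l// mulr2n mulrDl mul1r.
have le_tr l : re (A l l) <= re_trace A.
  rewrite /re_trace (bigD1 l)//= lerDl; apply: sumr_ge0 => m _.
  by have /andP[] := idempotent_diag m AA.
by rewrite lerD.
Qed.

End trace_form.

(** * The real part on the reals, the complex numbers and the quaternions *)

Section dyson_trace_forms.
Variable R : realType.

(** A weak arithmetic-geometric inequality; the sharp factor 1/2 is immaterial because [trace_form]
    leaves [M] free. *)
Lemma mul_bound (a b : R) : - (a * a + b * b) <= a * b <= a * a + b * b.
Proof.
have := sqr_ge0 (a - b); have := sqr_ge0 (a + b); have := sqr_ge0 a; have := sqr_ge0 b.
by rewrite !expr2 => *; apply/andP; split; nra.
Qed.

Lemma real_trace_form : trace_form (id : R^o -> R).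
Proof.
split => [a x y|x|phi L]; [by []|by rewrite expr2|].
exists `|phi 1| => // x y.
rewrite -[x * star y]mulr1 (real_linearZ _ _ L : phi ((x * star y) *: (1 : R^o)) = _).
rewrite normrM mulrC ler_wpM2l//=.
rewrite /star /= ler_norml; apply/andP; split; nra.
Qed.

Lemma complex_trace_form : trace_form (@complex.Re R : Rcomplex R -> R).
Proof.
split => [a [x1 x2] [y1 y2]|[x1 x2]|phi L] //=.
  by nra.
(* Each real coordinate of x times star y is at most |x|^2 + |y|^2 in absolute value, so the sum of
   |phi| over the standard basis serves as [M]; likewise for the quaternions. *)
exists (`|phi (Complex 1 0)| + `|phi (Complex 0 1)|); first by rewrite addr_ge0.
move=> [x1 x2] [y1 y2].
have E (w : Rcomplex R) : phi w =
    complex.Re w * phi (Complex 1 0) + complex.Im w * phi (Complex 0 1).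
  rewrite -!(real_linearZ _ _ L) -!(real_linearD L); congr (phi _).
  by case: w => a b; congr Complex => /=; ring.
rewrite E [leRHS]mulrDl; apply: le_trans (ler_normD _ _) _; rewrite !normrM.
apply: lerD; rewrite mulrC ler_wpM2l//= ler_norml.
  have /andP[? ?] := mul_bound x1 y1; have /andP[? ?] := mul_bound x2 y2.
  by apply/andP; split; lra.
have /andP[? ?] := mul_bound x1 y2; have /andP[? ?] := mul_bound x2 y1.
by apply/andP; split; lra.
Qed.

Lemma quaternion_trace_form : trace_form (@q_re R).
Proof.
split => [a [x1 x2 x3 x4] [y1 y2 y3 y4]|[x1 x2 x3 x4]|phi L] //=.
  by nra.
exists (`|phi (Quaternion 1 0 0 0)| + `|phi (Quaternion 0 1 0 0)| +
  `|phi (Quaternion 0 0 1 0)| + `|phi (Quaternion 0 0 0 1)|).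
  by rewrite !addr_ge0.
move=> [x1 x2 x3 x4] [y1 y2 y3 y4].
have E (w : quaternion R) : phi w =
    q_re w * phi (Quaternion 1 0 0 0) + q_i w * phi (Quaternion 0 1 0 0) +
    q_j w * phi (Quaternion 0 0 1 0) + q_k w * phi (Quaternion 0 0 0 1).
  rewrite -!(real_linearZ _ _ L) -!(real_linearD L); congr (phi _).
  by case: w => a b c d; congr Quaternion => /=; ring.
rewrite E !(mulrDl _ _ (q_re _ + _)).
have normD_le (a b A B : R) : `|a| <= A -> `|b| <= B -> `|a + b| <= A + B.
  by move=> aA bB; apply: le_trans (ler_normD _ _) _; exact: lerD.
apply: (normD_le); [apply: (normD_le); [apply: (normD_le)|]|];
  rewrite normrM mulrC ler_wpM2l//= ler_norml.
- have /andP[? ?] := mul_bound x1 y1; have /andP[? ?] := mul_bound x2 y2.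
  have /andP[? ?] := mul_bound x3 y3; have /andP[? ?] := mul_bound x4 y4.
  by apply/andP; split; lra.
- have /andP[? ?] := mul_bound x1 y2; have /andP[? ?] := mul_bound x2 y1.
  have /andP[? ?] := mul_bound x3 y4; have /andP[? ?] := mul_bound x4 y3.
  by apply/andP; split; lra.
- have /andP[? ?] := mul_bound x1 y3; have /andP[? ?] := mul_bound x3 y1.
  have /andP[? ?] := mul_bound x2 y4; have /andP[? ?] := mul_bound x4 y2.
  by apply/andP; split; lra.
- have /andP[? ?] := mul_bound x1 y4; have /andP[? ?] := mul_bound x4 y1.
  have /andP[? ?] := mul_bound x2 y3; have /andP[? ?] := mul_bound x3 y2.
  by apply/andP; split; lra.
Qed.

Lemma dyson_trace_form beta : exists re : dyson_algebra R beta -> R, trace_form re.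
Proof.
(* Every index other than 1 and 2, including 0, falls into the quaternionic branch of
   [dyson_algebra]. *)
case: beta => [|[|[|beta]]]; [exists (@q_re R)|exists id|exists (@complex.Re R)|
  exists (@q_re R)].
- exact: quaternion_trace_form.
- exact: real_trace_form.
- exact: complex_trace_form.
- exact: quaternion_trace_form.
Qed.

End dyson_trace_forms.

Section has_integral_transfer.
Context d1 d2 (T1 : measurableType d1) (T2 : measurableType d2) (R : realType).
Variables (m1 : {measure set T1 -> \bar R}) (m2 : {measure set T2 -> \bar R}).

(** Carries identities proved under the product law to any probability space on which the two
    variables are defined. *)
Lemma has_integral_transfer (phi : T1 -> T2) (F : T2 -> R) v :
  measurable_fun [set: T1] phi ->
  (forall C, measurable C -> m1 (phi @^-1` C) = m2 C) ->
  has_integral m2 F v -> has_integral m1 (F \o phi) v.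
Proof.
move=> mphi mE [iF Fv].
have mF : measurable_fun [set: T2] (EFin \o F) := measurable_int _ iF.
pose Q := measure_function_pushforward__canonical__measure_function_Measure m1 mphi.
have QE f : (\int[Q]_x f x = \int[m2]_x f x)%E.
  by apply: eq_measure_integral => C mC _; exact: mE.
have iphi : m1.-integrable [set: T1] (EFin \o (F \o phi)).
  apply/integrableP; split; first exact: measurableT_comp mF mphi.
  move/integrableP: iF => [_]; rewrite -QE ge0_integral_pushforward//.
  exact: measurableT_comp.
split => //; rewrite -Fv -QE.
exact/esym/(integral_pushforward mphi mF iphi measurableT).
Qed.

End has_integral_transfer.

(** * Support and rotation invariance of the jump law *)

Section bernoulli_ensemble.
Variables (R : realType) (K : starAlgType R) (n : nat).
Local Notation H := (herm K n).
Variables (haar : probability (unitary K n) R).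

Lemma herm_conj0 (U : unitary K n) : herm_conj U 0 = 0.
Proof. by apply: val_inj; rewrite /= mulmx0 mul0mx. Qed.

Lemma herm_conjD (U : unitary K n) : {morph (@herm_conj R K n U) : A B / A + B}.
Proof. by move=> A B; apply: val_inj; rewrite /= mulmxDr mulmxDl. Qed.

Lemma herm_conj_mul (U V : unitary K n) (A : H) :
  herm_conj (unitary_mul U V) A = herm_conj U (herm_conj V A).
Proof. by apply: val_inj; rewrite /= adjmxM !mulmxA. Qed.

Lemma herm_pid_idem m : idempotents K n (herm_pid K n m).
Proof. by rewrite /idempotents /= mul_pid_mx minnn pid_mx_minv. Qed.

Lemma herm_conj_idem (U : unitary K n) (A : H) :
  idempotents K n A -> idempotents K n (herm_conj U A).
Proof.
rewrite /idempotents /= => AA; have /andP[_ /eqP U'U] := unitaryP U.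
by rewrite !mulmxA -[X in X *m A *m _]mulmxA U'U mulmx1 -[U *m A *m A]mulmxA AA.
Qed.

Lemma bernoulli_law_idem q : bernoulli_law haar q (~` idempotents K n) = 0%E.
Proof.
rewrite /bernoulli_law diracE memNset ?mule0 ?add0e => [|/=]; last first.
  by apply; rewrite /idempotents /= mul0mx.
rewrite big1// => i _; rewrite /projection_law /pushforward.
rewrite (_ : _ @^-1` _ = set0) ?measure0 ?mule0//.
apply/seteqP; split => // U /=; apply.
by apply: herm_conj_idem; exact: herm_pid_idem.
Qed.

(** Conjugation by [U] sends the conjugate by V of a fixed projection to the conjugate by UV, so
    each projection law inherits the left invariance of Haar measure. *)
Lemma bernoulli_law_invariant q (U : unitary K n) (B : set H) : is_haar haar ->
  measurable B -> bernoulli_law haar q (herm_conj U @^-1` B) = bernoulli_law haar q B.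
Proof.
move=> haarP mB; rewrite /bernoulli_law; congr (_ + _)%E.
  congr (_ * _)%E; rewrite !diracE; congr (_%:R%:E); congr nat_of_bool.
  by apply/idP/idP; rewrite !inE /= herm_conj0.
apply: eq_bigr => i _; congr (_ * _)%E; rewrite /projection_law /pushforward.
have mD : measurable ((fun V => herm_conj V (herm_pid K n i.+1)) @^-1` B).
  by rewrite -[X in measurable X]setTI; exact: measurable_conj_unitary.
rewrite -(haarP U _ mD); congr (haar _).
by apply/seteqP; split => V /=; rewrite herm_conj_mul.
Qed.

End bernoulli_ensemble.

(** * The Poisson ensemble is Meixner *)

Section poisson_meixner.
Variables (R : realType) (K : starAlgType R) (n : nat) (re : K -> R).
Hypothesis re_form : trace_form re.
Local Notation H := (herm K n).
Variables (haar : probability (unitary K n) R) (lambda : 'I_n -> R).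
Hypotheses (haarP : is_haar haar) (lambda_gt0 : 0 < \sum_i lambda i).
Variables (mu : probability H R).

Section representation.
Context d (Omega : measurableType d) (P : probability Omega R).
Variables (N : {RV P >-> nat}) (X : nat -> {RV P >-> H}).
Let total := \sum_i lambda i.
Let q i := lambda i / total.
Hypothesis NE : forall k, distribution P N [set k] = (poisson_pmf total k)%:E.
Hypothesis XE : forall k (B : set H), measurable B ->
  distribution P (X k) B = bernoulli_law haar q B.
Hypothesis indX : independent_seq P X.
Hypothesis indN : independent_systems P
  (g_sigma_algebra_preimage (N : Omega -> nat))
  (sigma_algebra_seq (fun k => X k : Omega -> H)).
Hypothesis muE : forall B : set H, measurable B ->
  mu B = pushforward P (fun w => \sum_(k < N w) (X k w : H)) B.

(** [bernoulli_law] is only a set function; the law of one jump supplies the probability measure,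
    and by [XE] it is the law of every jump. *)
Let nu : probability H R := distribution P (X 0%N).
Let T : nat -> probability H R := psum_law X.

Let nuE B : measurable B -> nu B = bernoulli_law haar q B.
Proof. by move=> mB; exact: XE. Qed.

Let nu_idem : nu (~` idempotents K n) = 0.
Proof.
rewrite nuE ?bernoulli_law_idem//.
by apply: measurableC; exact: measurable_idempotent.
Qed.

Let T0E A : measurable A -> T 0%N A = \d_(0%R : H) A.
Proof.
move=> mA; rewrite [LHS](_ : _ = P (psum X 0 @^-1` A))//.
rewrite (_ : psum X 0 = cst 0); last by apply/funext => w; rewrite /psum big_ord0.
rewrite preimage_cst diracE; case: ifP => _; first exact: probability_setT.
exact: measure0.
Qed.

Let measurable_sum_set (A : set H) : measurable A ->
  measurable [set z : H * H | A (z.1 + z.2)%R].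
Proof.
by move=> mA; rewrite -[X in measurable X]setTI; apply: measurable_hermD_pair.
Qed.

Let TSE m A : measurable A -> (T m.+1 A = (T m \x nu) [set z : H * H | A (z.1 + z.2)%R])%E.
Proof.
move=> mA; rewrite [LHS](psum_lawS indX)//.
apply: product_measure_eq; [by []| |exact: measurable_sum_set].
by move=> B mB; rewrite nuE//; exact: XE.
Qed.

Let mu_mix A : measurable A ->
  (mu A = \sum_(m <oo) ((poisson_pmf total m)%:E * T m A))%E.
Proof.
move=> mA; rewrite muE// [LHS](random_sum_law mA indN).
by apply: eq_eseriesr => m _; rewrite -NE.
Qed.

Let mecke_mu (p : H -> R) (f : H -> \bar R) :
  nonneg_functional nu p -> measurable_fun [set: H] f -> (forall x, 0 <= f x)%E ->
  (\int[mu]_x ((`|p x|)%:E * f x) =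
  total%:E * \int[mu]_x \int[nu]_z ((`|p z|)%:E * f (x + z)%R))%E.
Proof. exact: (mecke T0E TSE lambda_gt0 mu_mix). Qed.

Let null_mu (p : H -> R) : nonneg_functional nu p -> mu [set z | p z < 0] = 0.
Proof. exact: (null_mixture T0E TSE mu_mix). Qed.

(** Conjugation is additive, so it passes through convolution: on rectangles the conjugated pair has
    the same product law. *)
Let T_invariant m (U : unitary K n) A : measurable A ->
  T m (herm_conj U @^-1` A) = T m A.
Proof.
have mU : measurable_fun [set: H] (@herm_conj R K n U).
  exact: (@measurable_herm_conj _ _ _ _ _ (fun A : H => A)).
have mUA (B : set H) : measurable B -> measurable (herm_conj U @^-1` B).
  by move=> mB; rewrite -[X in measurable X]setTI; exact: mU.
elim: m A => [|m IHm] A mA.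
  rewrite !T0E//; last exact: mUA.
  rewrite !diracE; congr (_%:R%:E); congr nat_of_bool.
  by apply/idP/idP; rewrite !inE /= herm_conj0.
rewrite !TSE//; last exact: mUA.
have mphi : measurable_fun [set: H * H]
    (fun z : H * H => (herm_conj U z.1, herm_conj U z.2)).
  by apply: measurable_fun_pair; exact: measurableT_comp.
pose Q := measure_function_pushforward__canonical__measure_function_Measure
  (T m \x nu)%E mphi.
rewrite [RHS](@product_measure_unique _ _ _ _ R (T m) nu Q); last exact: measurable_sum_set.
  rewrite /Q /= /pushforward; congr ((_ \x _)%E _).
  by apply/seteqP; split => z /=; rewrite herm_conjD.
move=> B C mB mC.
rewrite [LHS](_ : _ = (T m \x nu)%E ((herm_conj U @^-1` B) `*` (herm_conj U @^-1` C)))//.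
rewrite product_measure1E//; [|exact: mUA|exact: mUA].
congr (_ * _)%E; first exact: IHm.
rewrite [LHS]nuE; last exact: mUA.
by rewrite bernoulli_law_invariant// -nuE.
Qed.

Lemma poisson_rotation_invariant : rotation_invariant mu.
Proof.
move=> U B mB; rewrite !mu_mix//.
  by apply: eq_eseriesr => m _; rewrite T_invariant.
rewrite -[X in measurable X]setTI.
exact: (@measurable_herm_conj _ _ _ _ _ (fun A : H => A)).
Qed.

Lemma poisson_second_moments : finite_second_moments mu.
Proof.
apply: (finite_second_moments_tame lambda_gt0 mecke_mu null_mu nu_idem).
exact: (coord_tame re_form).
Qed.

Lemma poisson_coord_identity i j k A : measurable A -> exists v,
  has_integral (iid_pair mu)
    (fun w => mx_coord i j k ((w.1 - w.2 : 'M[K]_n) ^+ 2) * sum_in A w) v /\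
  has_integral (iid_pair mu)
    (fun w => mx_coord i j k (w.1 + w.2 : 'M[K]_n) * sum_in A w) v.
Proof.
apply: (coord_conditional_identity lambda_gt0 mecke_mu null_mu nu_idem).
exact: (coord_tame re_form).
Qed.

End representation.

Lemma poisson_is_meixner : poisson_ensemble haar lambda mu -> meixner mu 0 1 0.
Proof.
move=> [d [ Omega [ P [ N [ X [ NE XE indX indN muE ]]]]]].
have ident := poisson_coord_identity NE XE indX indN muE.
split.
- exact: (poisson_rotation_invariant NE XE indX indN muE).
- exact: (poisson_second_moments NE XE indX indN muE).
(* The space representing the Poisson sum is discarded: [ident] speaks of [mu] alone, while X and Y
   live on an arbitrary space. *)
move=> {d Omega P N X NE XE indX indN muE} d Omega P X Y XE YE indXY i j k z v.
have mXY : measurable_fun [set: Omega] (fun w => (X w, Y w) : H * H).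
  exact: measurable_fun_pair.
have lawE C : measurable C -> P ((fun w => (X w, Y w) : H * H) @^-1` C) = iid_pair mu C.
  move=> mC; rewrite [LHS](joint_law indXY mC).
  exact: product_measure_eq.
have vE w : v w = mx_coord i j k (X w + Y w : 'M[K]_n).
  by rewrite /v !scale0r !scale1r add0r raddf0 addr0.
have transfer F u : has_integral (iid_pair mu) F u ->
    has_integral P (fun w => F (X w, Y w)) u.
  exact: has_integral_transfer.
have full (w : H * H) : sum_in setT w = 1 :> R.
  by rewrite /sum_in indicE in_setT.
(* The full set yields integrability of both sides; a general [A] gives the integrals over the
   events of S. *)
have [u [zu vu]] := ident i j k setT measurableT.
split.
- case: (transfer _ _ zu) => + _; apply: eq_integrable => // w _ /=.
  by rewrite full mulr1.
- case: (transfer _ _ vu) => + _; apply: eq_integrable => // w _ /=.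
  by rewrite full mulr1 vE.
- move=> B mB; exists ((fun A : H => mx_coord i j k A) @^-1` B).
    by rewrite -[X in measurable X]setTI; exact: measurable_mx_coord.
  by rewrite setTI; apply/seteqP; split => w /=; rewrite vE.
move=> _ [A mA <-].
have [u' [/transfer[_ zu'] /transfer[_ vu']]] := ident i j k A mA.
have memE w : (w \in (X \+ Y : Omega -> H) @^-1` A) = (X w + Y w \in A).
  by apply/idP/idP; rewrite !inE.
rewrite setTI integral_mkcond [RHS]integral_mkcond.
transitivity (u'%:E); [rewrite -zu'|rewrite -vu']; apply: eq_integral => w _;
  rewrite /patch memE /sum_in indicE /=; case: ifP => _;
  by rewrite ?mulr1 ?mulr0 ?vE.
Qed.

End poisson_meixner.

Theorem proposition3p6 (R : realType) (beta : nat) (hbeta : beta \in [:: 1; 2; 4]%N)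
    (n : nat) (hn : (1 <= n)%N)
    (haar : probability (unitary (dyson_algebra R beta) n) R) (hhaar : is_haar haar)
    (lambda : 'I_n -> R) (lambda_ge0 : forall i, 0 <= lambda i)
    (lambda_gt0 : 0 < \sum_i lambda i)
    (mu : probability (herm (dyson_algebra R beta) n) R) :
  poisson_ensemble haar lambda mu -> meixner mu 0 1 0.
Proof.
have [re re_form] := dyson_trace_form R beta.
exact: (poisson_is_meixner re_form hhaar lambda_gt0).
Qed.
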